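(* Let $1<\gamma<2$, $0\le\delta\le1$, let $X$ be a Banach space and let $\mathcal{A}$ be the generator of a general fractional cosine operator function $\{C_{\gamma,\delta}(t)\}_{t>0}$ of order $\gamma$ and type $\delta$ on $X$. Then for every $x\in D(\mathcal{A})$, $\omega(t)=C_{\gamma,\delta}(t)x$ is a strong solution of the problem $$D_0^{\gamma,\delta}\omega(t)=\mathcal{A}\omega(t),\ t>0,\qquad (g_{(1-\delta)(2-\gamma)}*\omega)(0)=x,\quad (g_{(1-\delta)(2-\gamma)}*\omega)'(0)=0.$$
   Context: For $\alpha>0$, $J_t^{\alpha}f(t)=\frac{1}{\Gamma(\alpha)}\int_0^t(t-s)^{\alpha-1}f(s)\,ds$, and $J_t^0$ is the identity; for an operator family, $J_t^\alpha C(t)x$ denotes $J_t^\alpha$ applied to $t\mapsto C(t)x$. The Hilfer fractional derivative is $D_0^{\gamma,\delta}\omega(t)=J_t^{\delta(2-\gamma)}\frac{d^2}{dt^2}J_t^{(1-\delta)(2-\gamma)}\omega(t)$. Here $g_\alpha(t)=t^{\alpha-1}/\Gamma(\alpha)$ for $\alpha>0$, so $g_\alpha*\omega=J_t^\alpha\omega$, with $g_0*\omega=\omega$; values at $0$ are limits as $t\to0+$. A general fractional cosine operator function of order $\gamma\in(1,2)$ and type $\delta\in[0,1]$ is a family $\{C_{\gamma,\delta}(t)\}_{t>0}$ of bounded linear operators on $X$ such that: (i) $C_{\gamma,\delta}(t)$ is strongly continuous (on $t>0$); (ii) $\lim_{t\to0+}\frac{C_{\gamma,\delta}(t)x}{t^{\gamma+\delta(2-\gamma)-2}}=\frac{x}{\Gamma(\gamma+\delta(2-\gamma)-1)}$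 for all $x\in X$; (iii) $C_{\gamma,\delta}(t)C_{\gamma,\delta}(s)=C_{\gamma,\delta}(s)C_{\gamma,\delta}(t)$ for all $t,s>0$; (iv) for all $t,s>0$, $$C_{\gamma,\delta}(s)J_t^{\gamma}C_{\gamma,\delta}(t)-J_s^{\gamma}C_{\gamma,\delta}(s)C_{\gamma,\delta}(t)=\frac{s^{\gamma+\delta(2-\gamma)-2}}{\Gamma(\gamma+\delta(2-\gamma)-1)}J_t^{\gamma}C_{\gamma,\delta}(t)-\frac{t^{\gamma+\delta(2-\gamma)-2}}{\Gamma(\gamma+\delta(2-\gamma)-1)}J_s^{\gamma}C_{\gamma,\delta}(s).$$ Its generator is the linear operator $\mathcal{A}:D(\mathcal{A})\subset X\to X$ given by $$\mathcal{A}x=\Gamma(2\gamma+\delta(2-\gamma)-1)\lim_{t\to0+}\frac{C_{\gamma,\delta}(t)x-\frac{t^{\gamma+\delta(2-\gamma)-2}}{\Gamma(\gamma+\delta(2-\gamma)-1)}x}{t^{2\gamma+\delta(2-\gamma)-2}},$$ with $D(\mathcal{A})$ the set of all $x\in X$ for which this limit exists. A function $\omega\in C((0,\infty),X)$ is a strong solution of the problem $D_0^{\gamma,\delta}\omega(t)=\mathcal{A}\omega(t)$, $t>0$, with initial conditions $(g_{(1-\delta)(2-\gamma)}*\omega)(0)=x$ and $(g_{(1-\delta)(2-\gamma)}*\omega)'(0)=0$, if $\omega(t)\in D(\mathcal{A})$ for $t>0$, $D_0^{\gamma,\delta}\omega(t)$ is continuous on $(0,\infty)$, and the equation and initial conditions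 hold.
   Formalization: The Hilfer derivative is taken in regularised form: with g = J^{(1-δ)(2-γ)}ω and ε = δ(2-γ), J^ε g'' means (d²/dt²)J^ε(g − g(0) − t g'(0)). The literal form can fail to exist at δ = 1; both agree when g is C² with g'' integrable at 0 and J^ε g'' continuous. *)

(* Defs.v *)
From Stdlib Require Import Reals.
From Coquelicot Require Import Coquelicot.
Open Scope R_scope.

(** Banach spaces are [CompleteNormedModule R_AbsRing].  A complex Banach space
    is one by restriction of scalars, and none of the notions below changes.
    Only the values of functions on (0, oo) matter; [Rpower] is applied to
    positive bases only. *)

Definition Gamma (a : R) : R :=
  RInt_gen (fun s => Rpower s (a - 1) * exp (- s)) (at_right 0) (Rbar_locally p_infty).

(** [pow_g a t] is g_a(t) = t^(a-1) / Gamma(a). *)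
Definition pow_g (a t : R) : R := Rpower t (a - 1) / Gamma a.

Section FractionalCalculus.

Context {X : CompleteNormedModule R_AbsRing}.

Definition cont_pos (f : R -> X) : Prop := forall t, 0 < t -> continuous f t.

Definition lim0 (f : R -> X) (v : X) : Prop := filterlim f (at_right 0) (locally v).

Definition deriv_pos (f f' : R -> X) : Prop := forall t, 0 < t -> is_derive f t (f' t).

Definition J_integrand (alpha : R) (f : R -> X) (t s : R) : X :=
  scal (Rpower (t - s) (alpha - 1)) (f s).

(** The integral may be improper at both endpoints. *)
Definition J (alpha : R) (f : R -> X) (t : R) : X :=
  if Req_EM_T alpha 0 then f t
  else scal (/ Gamma alpha) (RInt_gen (J_integrand alpha f t) (at_right 0) (at_left t)).

(** Existence of the integral in [J], with absolute convergence: for [f]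
    continuous on (0, oo) this is Bochner integrability of the integrand. *)
Definition ex_J (alpha : R) (f : R -> X) (t : R) : Prop :=
  alpha = 0 \/
  (ex_RInt_gen (J_integrand alpha f t) (at_right 0) (at_left t) /\
   ex_RInt_gen (fun s => norm (J_integrand alpha f t s)) (at_right 0) (at_left t)).

(** g(t) - g0 - t g0' *)
Definition taylor_rem (g : R -> X) (g0 g0' : X) (t : R) : X :=
  minus (minus (g t) g0) (scal t g0').

(** [is_J_D2 eps g h] : h = J^eps (d^2/dt^2) g on (0, oo), in the usual
    regularised (Caputo) sense
      J^eps g'' := d^2/dt^2 J^eps (g - g(0) - t g'(0)).
    The two sides agree when g is C^2 on (0, oo) with g'' integrable near 0 and
    J^eps g'' continuous, since then g - g(0) - t g'(0) = J^2 g''; for eps = 0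
    both are g''.
    For eps > 0 the right-hand side does not require g to be twice
    differentiable.  This is needed: for gamma in (1,2) and delta = 1, on
    complex L^2(0, oo), let C(t) be multiplication by E_gamma(t^gamma m(r)) with
    m(r) = r exp(i pi gamma / 2) and E_gamma the Mittag-Leffler function.  Its
    generator is multiplication by m, and t |-> C(t) x is not twice
    differentiable, at any t > 0, if m x is in L^2 but r^(2/gamma) x is not. *)
Definition is_J_D2 (eps : R) (g h : R -> X) : Prop :=
  exists (g' k' : R -> X) (g0 g0' : X),
    deriv_pos g g' /\ lim0 g g0 /\ lim0 g' g0' /\
    (forall t, 0 < t -> ex_J eps (taylor_rem g g0 g0') t) /\
    deriv_pos (J eps (taylor_rem g g0 g0')) k' /\
    deriv_pos k' h.

(** [is_hilfer gamma delta w h] : h is the Hilfer derivative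
    J^(delta(2-gamma)) (d^2/dt^2) J^((1-delta)(2-gamma)) w on (0, oo). *)
Definition is_hilfer (gamma delta : R) (w h : R -> X) : Prop :=
  (forall t, 0 < t -> ex_J ((1 - delta) * (2 - gamma)) w t) /\
  is_J_D2 (delta * (2 - gamma)) (J ((1 - delta) * (2 - gamma)) w) h.

(** The singular coefficient t^(gamma+delta(2-gamma)-2)/Gamma(gamma+delta(2-gamma)-1) is [pow_g]
    at gamma+delta(2-gamma)-1.  In the last clause the integrals converge by
    the first two. *)
Record general_fractional_cosine (gamma delta : R) (C : R -> X -> X) : Prop := {
  gfc_bounded : forall t, 0 < t -> is_linear (C t);
  gfc_continuous : forall x, cont_pos (fun t => C t x);
  gfc_initial : forall x,
    lim0 (fun t => scal (/ Rpower t (gamma + delta * (2 - gamma) - 2)) (C t x))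
         (scal (/ Gamma (gamma + delta * (2 - gamma) - 1)) x);
  gfc_comm : forall t s x, 0 < t -> 0 < s -> C t (C s x) = C s (C t x);
  gfc_functional : forall t s x, 0 < t -> 0 < s ->
    minus (C s (J gamma (fun r => C r x) t))
          (J gamma (fun r => C r (C t x)) s)
    = minus
        (scal (pow_g (gamma + delta * (2 - gamma) - 1) s) (J gamma (fun r => C r x) t))
        (scal (pow_g (gamma + delta * (2 - gamma) - 1) t) (J gamma (fun r => C r x) s))
}.

(** Unbounded operators are given by their graph: [A x y] means that x is in
    D(A) and A x = y. *)
Definition dom (A : X -> X -> Prop) (x : X) : Prop := exists y, A x y.

Definition generator (gamma delta : R) (C : R -> X -> X) (x y : X) : Prop :=
  exists l : X,
    lim0 (fun t =>
            scal (/ Rpower t (2 * gamma + delta * (2 - gamma) - 2))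
              (minus (C t x) (scal (pow_g (gamma + delta * (2 - gamma) - 1) t) x))) l /\
    y = scal (Gamma (2 * gamma + delta * (2 - gamma) - 1)) l.

(** [A (w t) (h t)] says both that w(t) is in D(A) and that the equation holds
    at t. *)
Definition strong_solution (gamma delta : R) (A : X -> X -> Prop) (x : X)
    (w : R -> X) : Prop :=
  cont_pos w /\
  (exists h : R -> X,
     is_hilfer gamma delta w h /\ cont_pos h /\ forall t, 0 < t -> A (w t) (h t)) /\
  lim0 (J ((1 - delta) * (2 - gamma)) w) x /\
  (exists g' : R -> X,
     deriv_pos (J ((1 - delta) * (2 - gamma)) w) g' /\ lim0 g' zero).

End FractionalCalculus.

(* Main.v *)
(** Put beta = gamma + delta (2 - gamma) - 1, so that 0 < beta <= 1 and
    C(t) x ~ g_beta(t) x at 0.  By the functional equation and commutation,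
    J_t^gamma C(t) [C(s) x - g_beta(s) x] = J_s^gamma C(s) [C(t) x - g_beta(t) x].
    Dividing by s^(gamma+beta-1) and letting s -> 0 gives, for x in D(A),
    C(t) x = g_beta(t) x + J_t^gamma C(t) A x; the limit may be taken inside
    J_t^gamma C(t) because s^(1-beta) C(s) is bounded uniformly on (0, t]
    (uniform boundedness principle).  The Hilfer derivative of the right-hand side
    is then C(t) A x by the semigroup law J^a J^b = J^(a+b).

    The semigroup law needs no Fubini theorem.  On r^(c-1) phi(r) with phi continuous,
    both J^a J^b and J^(a+b) are bounded in the supremum norm of phi, and on
    monomials phi their ratio is a constant not depending on the degree, by the
    recursion for the Beta function.  Hence J^a J^b = k J^(a+b) by Bernstein
    approximation.  Testing on the exponential as t -> oo, where J^a exp (t) ~ exp t,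
    gives k = 1 for c = 1, which is the formula
    B(a,b) = Gamma(a) Gamma(b) / Gamma(a+b), and this formula gives k = 1 for all c. *)

Require Import Defs.
From Stdlib Require Import Reals Lra Lia Psatz.
From Stdlib Require Import ssreflect.
From Stdlib Require Import FunctionalExtensionality Classical ClassicalEpsilon.
From Coquelicot Require Import Coquelicot.
Open Scope general_if_scope.
Open Scope R_scope.
Set SsrOldRewriteGoalsOrder.

(** * Improper integrals *)

(** Everything rests on one normal form: f(r) = r^(b-1) phi(r) for r > 0, with phi continuous on all
    of R. The substitution s = t u turns J^a f(t) into t^(a+b-1) times a mean of phi(t u) over the
    fixed interval (0,1), and both endpoint singularities sit in the scalar kernel (1-u)^(a-1)
    u^(b-1). Existence, continuity in t, norm bounds and behaviour at 0 thus become statements about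
    a continuous phi. The form is stable: J^a raises the exponent b to a + b and replaces phi by a
    multiple of its mean. An orbit of C has this form once t^(1-beta) C(t) x is extended to t <= 0
    by its limit at 0. Convergence of improper integrals is reduced to Cauchy estimates for a proper
    primitive, dominated by the increments of an explicit real function. The exponential is a
    convenient test function because J^a exp (t) is exp(t) times an incomplete Gamma integral
    divided by Gamma(a); this factor is monotone and bounded by its limit, so a sandwich argument
    identifies the constant. *)

Lemma norm_minus_sym {V : CompleteNormedModule R_AbsRing} (x y : V) :
  norm (minus x y) = norm (minus y x).
Proof. now rewrite -(opp_minus x y) norm_opp. Qed.

Lemma plus_minus_l {G : AbelianGroup} (x y : G) : minus (plus x y) x = y.
Proof.
  unfold minus.
  by rewrite (plus_comm x y) -plus_assoc plus_opp_r plus_zero_r.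
Qed.

Lemma plus_interchange {G : AbelianMonoid} (a b c d : G) :
  plus (plus a b) (plus c d) = plus (plus a c) (plus b d).
Proof.
  by rewrite -!plus_assoc (plus_assoc b) (plus_comm b c) -plus_assoc.
Qed.

Lemma minus_minus_cancel {G : AbelianGroup} (x y z : G) :
  minus (minus z x) (minus z y) = minus y x.
Proof.
  unfold minus. by rewrite opp_plus opp_opp plus_interchange plus_opp_r plus_zero_l plus_comm.
Qed.

Lemma minus_zero_eq {G : AbelianGroup} (x y : G) : minus x y = zero -> x = y.
Proof.
  intros E. transitivity (plus (minus x y) y).
  - unfold minus. by rewrite -plus_assoc plus_opp_l plus_zero_r.
  - by rewrite E plus_zero_l.
Qed.

(** The norm axiom gives one inequality; the other is the same axiom applied to [/ l] and
    [scal l x]. *)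
Lemma norm_scal_R {V : NormedModule R_AbsRing} (l : R) (x : V) :
  norm (scal l x) = Rabs l * norm x.
Proof.
  apply Rle_antisym; [exact (norm_scal l x)|].
  destruct (Req_dec l 0) as [->|Hl].
  - rewrite Rabs_R0 Rmult_0_l. apply norm_ge_0.
  - assert (E : x = scal (/ l) (scal l x)).
    { rewrite scal_assoc.
      replace (mult (/ l) l) with (@one R_Ring) by (unfold mult, one; simpl; field; auto).
      symmetry. exact (scal_one x). }
    rewrite {1}E.
    assert (H := norm_scal (/ l) (scal l x)). change (abs (/ l)) with (Rabs (/ l)) in H.
    assert (H1 : 0 < Rabs l) by now apply Rabs_pos_lt.
    rewrite Rabs_inv in H.
    apply Rmult_le_compat_l with (r := Rabs l) in H; [|lra].
    eapply Rle_trans; [exact H|]. right. field. lra.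
Qed.

Lemma norm_minus_triangle {V : CompleteNormedModule R_AbsRing} (x y z : V) :
  norm (minus x z) <= norm (minus x y) + norm (minus y z).
Proof.
  rewrite (minus_trans y x z). refine (norm_triangle (V := V) _ _).
Qed.

Lemma ball_of_norm {V : NormedModule R_AbsRing} (x y : V) (e : R) :
  norm (minus y x) < e -> ball x e y.
Proof. intros H. exact (norm_compat1 x y e H). Qed.

(** Balls and norm agree only up to the constant [norm_factor], hence the rescaled radius. *)
Lemma norm_of_ball {V : NormedModule R_AbsRing} (x y : V) (e : R) (He : 0 < e) :
  ball x (/ @norm_factor R_AbsRing V * e) y -> norm (minus y x) < e.
Proof.
  intros H.
  assert (Hf := @norm_factor_gt_0 R_AbsRing V).
  assert (He' : 0 < / @norm_factor R_AbsRing V * e).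
  { apply Rmult_lt_0_compat; auto. now apply Rinv_0_lt_compat. }
  assert (K := norm_compat2 x y (mkposreal _ He') H). simpl in K.
  replace (norm_factor * (/ norm_factor * e)) with e in K; auto.
  field. lra.
Qed.

Lemma filterlim_norm_iff {T : Type} {V : NormedModule R_AbsRing}
    (F : (T -> Prop) -> Prop) {FF : Filter F} (f : T -> V) (l : V) :
  filterlim f F (locally l) <->
  forall e, 0 < e -> F (fun t => norm (minus (f t) l) < e).
Proof.
  split.
  - intros H e He.
    assert (Hf := @norm_factor_gt_0 R_AbsRing V).
    assert (He' : 0 < / @norm_factor R_AbsRing V * e).
    { apply Rmult_lt_0_compat; auto. now apply Rinv_0_lt_compat. }
    generalize (proj1 (filterlim_locally f l) H (mkposreal _ He')). simpl.
    apply filter_imp; intros t Ht. now apply norm_of_ball.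
  - intros H. apply filterlim_locally. intros e.
    generalize (H e (cond_pos e)). apply filter_imp; intros t Ht.
    now apply ball_of_norm.
Qed.

Lemma filterlim_norm_le_0 {T : Type} {V : NormedModule R_AbsRing}
    (F : (T -> Prop) -> Prop) {FF : Filter F} (f : T -> V) (l : V) (g : T -> R) :
  F (fun t => norm (minus (f t) l) <= g t) -> filterlim g F (locally 0) ->
  filterlim f F (locally l).
Proof.
  intros H Hg. apply (proj2 (filterlim_norm_iff F f l)). intros e He.
  generalize (filter_and _ _ H (proj1 (filterlim_norm_iff F g 0) Hg e He)).
  apply filter_imp; intros t [H1 H2].
  apply Rle_lt_trans with (1 := H1).
  apply Rle_lt_trans with (2 := H2).
  replace (g t) with (minus (g t) 0) at 1; [apply Rle_abs|].
  unfold minus, plus, opp; simpl; lra.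
Qed.

(** Once a single function [Phi] has the proper integrals as increments, only its two endpoint
    limits matter. [Phi] is later either an antiderivative or [RInt f c]. *)
Lemma is_RInt_gen_primitive {V : NormedModule R_AbsRing}
    (Fa Fb : (R -> Prop) -> Prop) {FFa : Filter Fa} {FFb : Filter Fb}
    (f Phi : R -> V) (la lb : V) :
  filter_prod Fa Fb
    (fun ab => is_RInt f (fst ab) (snd ab) (minus (Phi (snd ab)) (Phi (fst ab)))) ->
  filterlim Phi Fa (locally la) -> filterlim Phi Fb (locally lb) ->
  is_RInt_gen f Fa Fb (minus lb la).
Proof.
  intros Hf Ha Hb P HP.
  assert (HL : filterlim (fun ab : R * R => minus (Phi (snd ab)) (Phi (fst ab)))
      (filter_prod Fa Fb) (locally (minus lb la))).
  { eapply (filterlim_comp_2 (fun ab : R * R => Phi (snd ab))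
      (fun ab : R * R => opp (Phi (fst ab))) plus).
    - eapply filterlim_comp; [apply filterlim_snd|exact Hb].
    - eapply filterlim_comp; [eapply filterlim_comp; [apply filterlim_fst|exact Ha]|].
      apply filterlim_opp.
    - apply (filterlim_plus lb (opp la)). }
  unfold filtermapi.
  assert (HL' : filter_prod Fa Fb (fun ab => P (minus (Phi (snd ab)) (Phi (fst ab)))))
    by exact (HL P HP).
  generalize (filter_and _ _ Hf HL'). apply filter_imp.
  intros ab [H1 H2]. exists (minus (Phi (snd ab)) (Phi (fst ab))).
  split; [exact H1|exact H2].
Qed.

(** Order-convexity, so that one argument serves the intervals (0,1), (0,t) and (0,oo). *)
Definition convex (D : R -> Prop) : Prop :=
  forall x y z, D x -> D y -> x <= z <= y -> D z.

Lemma convex_minmax (D : R -> Prop) (x y z : R) :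
  convex D -> D x -> D y -> Rmin x y <= z <= Rmax x y -> D z.
Proof.
  intros HD Hx Hy. unfold Rmin, Rmax.
  destruct (Rle_dec x y); intros; [apply (HD x y) | apply (HD y x)]; auto; lra.
Qed.

Lemma ex_RInt_convex {V : CompleteNormedModule R_AbsRing} (D : R -> Prop)
    (f : R -> V) (u v : R) :
  convex D -> (forall x, D x -> continuous f x) -> D u -> D v -> ex_RInt f u v.
Proof.
  intros HD Hf Hu Hv. apply (ex_RInt_continuous (V := V) f u v).
  intros z Hz. apply Hf. now apply (convex_minmax D u v).
Qed.

(** * Domination by a function with an explicit primitive *)

Section Domination.

Context {V : CompleteNormedModule R_AbsRing}.
Variables (D : R -> Prop) (f : R -> V) (g G : R -> R) (c : R).
Hypothesis HD : convex D.
Hypothesis Hc : D c.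
Hypothesis Hf : forall x, D x -> continuous f x.
Hypothesis Hg : forall x, D x -> continuous g x.
Hypothesis HG : forall x, D x -> is_derive G x (g x).
Hypothesis Hfg : forall x, D x -> norm (f x) <= g x.

(** Since G' = g dominates the norm of f, the increments of [RInt f c] are at most those of [G]. A
    limit of [G] therefore makes [RInt f c] Cauchy. *)
Lemma dominated_RInt_diff (u v : R) : D u -> D v ->
  norm (minus (RInt f c v) (RInt f c u)) <= Rabs (G v - G u).
Proof.
  assert (E : forall u v, D u -> D v -> u <= v ->
    norm (minus (RInt f c v) (RInt f c u)) <= Rabs (G v - G u)).
  { clear u v. intros u v Hu Hv Huv.
    replace (minus (RInt f c v) (RInt f c u)) with (RInt f u v).
    2:{ rewrite -(RInt_Chasles f c u v); try now apply (ex_RInt_convex D).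
        now rewrite plus_minus_l. }
    apply Rle_trans with (2 := Rle_abs _).
    apply (norm_RInt_le f g u v); auto.
    - intros x Hx. apply Hfg. now apply (HD u v).
    - apply RInt_correct. now apply (ex_RInt_convex D).
    - apply (is_RInt_derive G g u v); intros x Hx; [apply HG | apply Hg];
        now apply (convex_minmax D u v). }
  intros Hu Hv. destruct (Rle_lt_dec u v).
  - now apply E.
  - rewrite norm_minus_sym Rabs_minus_sym. apply E; auto. lra.
Qed.

Lemma dominated_primitive_limit (F : (R -> Prop) -> Prop) {FF : ProperFilter F}
    (lG : R) : F D -> filterlim G F (locally lG) ->
  exists l : V, filterlim (RInt f c) F (locally l).
Proof.
  intros FD HlG. apply (proj1 (filterlim_locally_cauchy (F := F) (RInt f c))). intros e.
  assert (He2 : 0 < e / 2) by (destruct e; simpl; lra).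
  exists (fun u => D u /\ norm (minus (G u) lG) < e / 2). split.
  - apply filter_and; auto. now apply (proj1 (filterlim_norm_iff F G lG)).
  - intros u v [Du Hu] [Dv Hv]. refine (ball_of_norm (V := V) _ _ _ _).
    apply Rle_lt_trans with (1 := dominated_RInt_diff u v Du Dv).
    revert Hu Hv. unfold norm, minus, plus, opp; simpl. unfold abs; simpl.
    intros Hu Hv. apply Rabs_def1.
    + apply Rabs_def2 in Hu. apply Rabs_def2 in Hv. lra.
    + apply Rabs_def2 in Hu. apply Rabs_def2 in Hv. lra.
Qed.

End Domination.

Lemma is_RInt_gen_RInt_primitive {V : CompleteNormedModule R_AbsRing}
    (D : R -> Prop) (f : R -> V) (c : R) (Fa Fb : (R -> Prop) -> Prop)
    {FFa : Filter Fa} {FFb : Filter Fb} (la lb : V) :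
  convex D -> D c -> (forall x, D x -> continuous f x) -> Fa D -> Fb D ->
  filterlim (RInt f c) Fa (locally la) -> filterlim (RInt f c) Fb (locally lb) ->
  is_RInt_gen f Fa Fb (minus lb la).
Proof.
  intros HD Hc Hf Da Db Ha Hb.
  apply is_RInt_gen_primitive with (RInt f c); auto.
  apply Filter_prod with (1 := Da) (2 := Db). simpl. intros u v Hu Hv.
  assert (E : minus (RInt f c v) (RInt f c u) = RInt f u v).
  { rewrite -(RInt_Chasles f c u v); try now apply (ex_RInt_convex D).
    now rewrite plus_minus_l. }
  rewrite E. apply RInt_correct. now apply (ex_RInt_convex D).
Qed.

Lemma ex_RInt_gen_dominated {V : CompleteNormedModule R_AbsRing}
    (D : R -> Prop) (f : R -> V) (g G : R -> R) (c : R) (Fa Fb : (R -> Prop) -> Prop)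
    {FFa : ProperFilter Fa} {FFb : ProperFilter Fb} (la lb : R) :
  convex D -> D c -> (forall x, D x -> continuous f x) ->
  (forall x, D x -> continuous g x) -> (forall x, D x -> is_derive G x (g x)) ->
  (forall x, D x -> norm (f x) <= g x) -> Fa D -> Fb D ->
  filterlim G Fa (locally la) -> filterlim G Fb (locally lb) ->
  ex_RInt_gen f Fa Fb.
Proof.
  intros HD Hc Hf Hg HG Hfg Da Db Ha Hb.
  destruct (dominated_primitive_limit D f g G c HD Hc Hf Hg HG Hfg Fa la Da Ha) as [l1 H1].
  destruct (dominated_primitive_limit D f g G c HD Hc Hf Hg HG Hfg Fb lb Db Hb) as [l2 H2].
  exists (minus l2 l1). apply (is_RInt_gen_RInt_primitive D f c); auto; apply filter_filter.
Qed.

Lemma is_RInt_gen_derive {V : CompleteNormedModule R_AbsRing}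
    (D : R -> Prop) (F f : R -> V) (Fa Fb : (R -> Prop) -> Prop)
    {FFa : Filter Fa} {FFb : Filter Fb} (la lb : V) :
  convex D -> (forall x, D x -> is_derive F x (f x)) ->
  (forall x, D x -> continuous f x) -> Fa D -> Fb D ->
  filterlim F Fa (locally la) -> filterlim F Fb (locally lb) ->
  is_RInt_gen f Fa Fb (minus lb la).
Proof.
  intros HD HF Hf Da Db Ha Hb.
  apply is_RInt_gen_primitive with F; auto.
  apply Filter_prod with (1 := Da) (2 := Db). simpl. intros u v Hu Hv.
  apply (is_RInt_derive F f u v); intros x Hx; [apply HF | apply Hf];
    now apply (convex_minmax D u v).
Qed.

(** Riemann sums commute with [T], and [T] is continuous. *)
Lemma is_RInt_linear {U V : NormedModule R_AbsRing} (T : U -> V) (f : R -> U)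
    (a b : R) (l : U) :
  is_linear T -> is_RInt f a b l -> is_RInt (fun x => T (f x)) a b (T l).
Proof.
  intros HT Hf. unfold is_RInt in *.
  apply filterlim_ext with
    (fun ptd => T (scal (sign (b - a)) (Riemann_sum f ptd))).
  - intros ptd. rewrite (linear_scal T HT). f_equal.
    induction ptd using SF_cons_ind.
    + exact (linear_zero T HT).
    + now rewrite !Riemann_sum_cons (linear_plus T HT) (linear_scal T HT) IHptd.
  - eapply filterlim_comp; [exact Hf|]. now apply linear_cont.
Qed.

Lemma is_RInt_gen_linear {U V : NormedModule R_AbsRing} (T : U -> V) (f : R -> U)
    (Fa Fb : (R -> Prop) -> Prop) {FFa : Filter Fa} {FFb : Filter Fb} (l : U) :
  is_linear T -> is_RInt_gen f Fa Fb l ->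
  is_RInt_gen (fun x => T (f x)) Fa Fb (T l).
Proof.
  intros HT Hf P HP.
  assert (HTc : continuous T l) by now apply linear_cont.
  generalize (Hf _ (HTc P HP)). unfold filtermapi. apply filter_imp.
  intros ab [y [Hy Py]]. exists (T y). split; auto. now apply is_RInt_linear.
Qed.

(** The filters at the endpoints are transported by the affine map. For negative [p] it exchanges
    the two endpoints, as in the substitution s = t (1 - u). *)
Lemma is_RInt_gen_comp_lin {V : NormedModule R_AbsRing} (f : R -> V) (p q : R)
    (Fa Fb Ga Gb : (R -> Prop) -> Prop) {FFa : Filter Fa} {FFb : Filter Fb} (l : V) :
  filterlim (fun x => p * x + q) Fa Ga -> filterlim (fun x => p * x + q) Fb Gb ->
  is_RInt_gen f Ga Gb l ->
  is_RInt_gen (fun x => scal p (f (p * x + q))) Fa Fb l.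
Proof.
  intros Ha Hb Hf P HP.
  destruct (Hf P HP) as [Q1 Q2 H1 H2 H].
  unfold filtermapi. apply Filter_prod with (1 := Ha _ H1) (2 := Hb _ H2).
  simpl. intros x y Hx Hy. destruct (H _ _ Hx Hy) as [z [Hz Pz]].
  exists z. split; auto. now apply (is_RInt_comp_lin f p q).
Qed.

(** For a nonnegative integrand the integrals over intervals containing [c,d] are at least the one
    over [c,d], so they cannot come close to a smaller value. It yields strict positivity, and with
    c = d mere nonnegativity. *)
Lemma is_RInt_gen_ge_RInt (f : R -> R) (D : R -> Prop) (Fa Fb : (R -> Prop) -> Prop)
    {FFa : ProperFilter Fa} {FFb : ProperFilter Fb} (c d l : R) :
  convex D -> c <= d -> (forall x, D x -> continuous f x) ->
  (forall x, D x -> 0 <= f x) -> D c -> D d ->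
  Fa (fun x => D x /\ x <= c) -> Fb (fun x => D x /\ d <= x) ->
  is_RInt_gen f Fa Fb l -> RInt f c d <= l.
Proof.
  intros HD Hcd Hf Hpos Dc Dd Ha Hb Hl.
  apply Rnot_lt_le. intros Hlt.
  assert (He : 0 < RInt f c d - l) by lra.
  assert (HP : locally l (fun y => y < RInt f c d)).
  { exists (mkposreal _ He). simpl. intros y Hy.
    apply Rabs_def2 in Hy. unfold minus, plus, opp in Hy; simpl in Hy. lra. }
  assert (Hab : filter_prod Fa Fb (fun ab : R * R =>
    (D (fst ab) /\ fst ab <= c) /\ (D (snd ab) /\ d <= snd ab))).
  { apply Filter_prod with (1 := Ha) (2 := Hb). simpl. tauto. }
  assert (Hl' : filter_prod Fa Fb (fun ab : R * R =>
    exists z, is_RInt f (fst ab) (snd ab) z /\ z < RInt f c d)) by exact (Hl _ HP).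
  destruct (filter_ex _ (filter_and _ _ Hl' Hab))
    as [[x y] [[z [Hz Hlz]] [[Dx Hx] [Dy Hy]]]]. simpl in *.
  assert (z = RInt f x y) by (symmetry; now apply is_RInt_unique). subst z.
  assert (E : forall u v, D u -> D v -> ex_RInt f u v)
    by (intros; now apply (ex_RInt_convex (V := R_CompleteNormedModule) D)).
  assert (E1 := RInt_Chasles f x c y (E _ _ Dx Dc) (E _ _ Dc Dy)).
  assert (E2 := RInt_Chasles f c d y (E _ _ Dc Dd) (E _ _ Dd Dy)).
  rewrite -E1 -E2 in Hlz.
  unfold plus in Hlz; simpl in Hlz.
  assert (0 <= RInt f x c).
  { apply RInt_ge_0; auto. intros w Hw. apply Hpos. apply (HD x c); auto; lra. }
  assert (0 <= RInt f d y).
  { apply RInt_ge_0; auto. intros w Hw. apply Hpos. apply (HD d y); auto; lra. }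
  lra.
Qed.

(** * Real powers and one-sided limits *)

Lemma exp_nondecreasing (x y : R) : x <= y -> exp x <= exp y.
Proof. intros [H | ->]; [left; now apply exp_increasing | right; reflexivity]. Qed.

Lemma Rpower_pos (x a : R) : 0 < Rpower x a.
Proof. apply exp_pos. Qed.

Lemma is_derive_Rpower (a x : R) : 0 < x ->
  is_derive (fun x => Rpower x a) x (a * Rpower x (a - 1)).
Proof. intros Hx. apply is_derive_Reals. now apply derivable_pt_lim_power. Qed.

Lemma continuous_Rpower (a x : R) : 0 < x -> continuous (fun x => Rpower x a) x.
Proof.
  intros Hx. apply (ex_derive_continuous (V := R_NormedModule)).
  eexists. now apply is_derive_Rpower.
Qed.

Lemma at_right_interval (a b : R) : a < b -> at_right a (fun x => a < x < b).
Proof.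
  intros Hab. assert (He : 0 < b - a) by lra.
  exists (mkposreal _ He). simpl. intros y Hy Hay. apply Rabs_def2 in Hy.
  unfold minus, plus, opp in Hy; simpl in Hy. lra.
Qed.

Lemma at_left_interval (a b : R) : a < b -> at_left b (fun x => a < x < b).
Proof.
  intros Hab. assert (He : 0 < b - a) by lra.
  exists (mkposreal _ He). simpl. intros y Hy Hay. apply Rabs_def2 in Hy.
  unfold minus, plus, opp in Hy; simpl in Hy. lra.
Qed.

Lemma filterlim_Rpower_0 (a : R) : 0 < a ->
  filterlim (fun x => Rpower x a) (at_right 0) (locally 0).
Proof.
  intros Ha. apply (proj2 (filterlim_norm_iff (V := R_NormedModule) _ _ _)). intros e He.
  generalize (at_right_interval 0 (Rpower e (/ a)) (Rpower_pos _ _)).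
  apply filter_imp. intros x [Hx0 Hx].
  unfold minus, plus, opp, norm; simpl. unfold abs; simpl.
  rewrite Ropp_0 Rplus_0_r Rabs_pos_eq; [|left; apply Rpower_pos].
  replace e with (Rpower (Rpower e (/ a)) a).
  - apply Rlt_Rpower_l; lra.
  - rewrite Rpower_mult Rinv_l; [now apply Rpower_1|lra].
Qed.

Lemma filterlim_Rpower_0_left (a t : R) : 0 < a ->
  filterlim (fun x => Rpower (t - x) a) (at_left t) (locally 0).
Proof.
  intros Ha.
  apply (filterlim_comp _ _ _ (fun x => t - x) (fun x => Rpower x a) _ (at_right 0));
    [|now apply filterlim_Rpower_0].
  intros P [d Hd]. exists d. intros y Hy Hyt. apply Hd; [|lra].
  unfold ball in *; simpl in *. unfold AbsRing_ball, abs, minus, plus, opp in *; simpl in *.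
  apply Rabs_def2 in Hy. apply Rabs_def1; lra.
Qed.

Lemma convex_open (a b : R) : convex (fun x => a < x < b).
Proof. intros x y z; lra. Qed.

(** * The Euler kernel *)

Definition euler_kernel (a b u : R) : R := Rpower (1 - u) (a - 1) * Rpower u (b - 1).

Definition Beta (a b : R) : R :=
  RInt_gen (euler_kernel a b) (at_right 0) (at_left 1).

Lemma euler_kernel_pos (a b u : R) : 0 < euler_kernel a b u.
Proof. apply Rmult_lt_0_compat; apply Rpower_pos. Qed.

Lemma continuous_Rpower_1m (a u : R) : u < 1 -> continuous (fun u => Rpower (1 - u) a) u.
Proof.
  intros Hu. apply (continuous_comp (fun u => 1 - u) (fun x => Rpower x a)).
  - apply (continuous_minus (V := R_NormedModule)); [apply continuous_const|apply continuous_id].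
  - apply continuous_Rpower. lra.
Qed.

Lemma continuous_euler_kernel (a b u : R) : 0 < u < 1 -> continuous (euler_kernel a b) u.
Proof.
  intros Hu. apply (continuous_mult (K := R_AbsRing)).
  - apply continuous_Rpower_1m. lra.
  - apply continuous_Rpower. lra.
Qed.

(** On [1/2, 1] the absolute value of ln x is at most ln 2, whatever the sign of p. *)
Lemma Rpower_half_bound (p x : R) : / 2 <= x <= 1 -> Rpower x p <= exp (Rabs p * ln 2).
Proof.
  intros Hx. unfold Rpower. apply exp_nondecreasing.
  assert (H1 : ln (/ 2) <= ln x) by (apply ln_le; lra).
  rewrite ln_Rinv in H1; [|lra].
  assert (H2 : ln x <= 0) by (rewrite -ln_1; apply ln_le; lra).
  apply Rle_trans with (1 := Rle_abs _). rewrite Rabs_mult.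
  apply Rmult_le_compat_l; [apply Rabs_pos|].
  rewrite (Rabs_left1 (ln x)); lra.
Qed.

(** On each side of 1/2 only one factor can be singular, and the other is bounded by
    [Rpower_half_bound]. The sum covers both sides at once and has an elementary primitive. *)
Lemma euler_kernel_bound (a b u : R) : 0 < u < 1 ->
  euler_kernel a b u <=
    exp (Rabs (b - 1) * ln 2) * Rpower (1 - u) (a - 1) +
    exp (Rabs (a - 1) * ln 2) * Rpower u (b - 1).
Proof.
  intros Hu. unfold euler_kernel.
  assert (H1 := Rpower_pos (1 - u) (a - 1)). assert (H2 := Rpower_pos u (b - 1)).
  assert (H3 := exp_pos (Rabs (b - 1) * ln 2)).
  assert (H4 := exp_pos (Rabs (a - 1) * ln 2)).
  destruct (Rle_lt_dec u (/ 2)).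
  - assert (H5 := Rpower_half_bound (a - 1) (1 - u)). nra.
  - assert (H5 := Rpower_half_bound (b - 1) u). nra.
Qed.

(** The coefficients are free because the choice c1 = 1, c2 = 0, b = 1 also gives the exact
    primitive that evaluates [Beta a 1]. *)
Definition euler_majorant (c1 c2 a b u : R) : R :=
  c1 * Rpower (1 - u) (a - 1) + c2 * Rpower u (b - 1).

Definition euler_majorant_primitive (c1 c2 a b u : R) : R :=
  - (c1 / a) * Rpower (1 - u) a + c2 / b * Rpower u b.

Lemma is_derive_euler_majorant (c1 c2 a b u : R) : 0 < a -> 0 < b -> 0 < u < 1 ->
  is_derive (euler_majorant_primitive c1 c2 a b) u (euler_majorant c1 c2 a b u).
Proof.
  intros Ha Hb Hu. unfold euler_majorant_primitive, euler_majorant.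
  replace (c1 * Rpower (1 - u) (a - 1) + c2 * Rpower u (b - 1)) with
    (- (c1 / a) * ((-1) * (a * Rpower (1 - u) (a - 1)))
     + c2 / b * (b * Rpower u (b - 1))) by (field; lra).
  apply (is_derive_plus (V := R_NormedModule)).
  - apply is_derive_scal.
    apply (is_derive_comp (V := R_NormedModule) (fun x => Rpower x a) (fun u => 1 - u)).
    + apply is_derive_Rpower. lra.
    + auto_derive; auto; ring.
  - apply is_derive_scal. apply is_derive_Rpower. lra.
Qed.

Lemma continuous_euler_majorant (c1 c2 a b u : R) : 0 < u < 1 ->
  continuous (euler_majorant c1 c2 a b) u.
Proof.
  intros Hu. apply (continuous_plus (V := R_NormedModule)).
  - apply (continuous_scal_r (V := R_NormedModule)). apply continuous_Rpower_1m. lra.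
  - apply (continuous_scal_r (V := R_NormedModule)). apply continuous_Rpower. lra.
Qed.

Lemma filterlim_at_right_continuous {V : UniformSpace} (f : R -> V) (a : R) :
  continuous f a -> filterlim f (at_right a) (locally (f a)).
Proof.
  intros H. eapply filterlim_filter_le_1; [|exact H].
  apply filter_le_within.
Qed.

Lemma filterlim_at_left_continuous {V : UniformSpace} (f : R -> V) (a : R) :
  continuous f a -> filterlim f (at_left a) (locally (f a)).
Proof.
  intros H. eapply filterlim_filter_le_1; [|exact H].
  apply filter_le_within.
Qed.

Lemma filterlim_plus_R {T : Type} (F : (T -> Prop) -> Prop) {FF : Filter F}
  (f g : T -> R) (a b : R) : filterlim f F (locally a) -> filterlim g F (locally b) ->
  filterlim (fun x => f x + g x) F (locally (a + b)).
Proof.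
  intros Hf Hg. eapply (filterlim_comp_2 f g Rplus); [exact Hf|exact Hg|].
  apply (filterlim_plus (V := R_NormedModule) a b).
Qed.

Lemma filterlim_scal_R {T : Type} (F : (T -> Prop) -> Prop) {FF : Filter F}
  (f : T -> R) (k a : R) : filterlim f F (locally a) ->
  filterlim (fun x => k * f x) F (locally (k * a)).
Proof.
  intros Hf. eapply filterlim_comp; [exact Hf|].
  apply (filterlim_scal_r (V := R_NormedModule) k a).
Qed.

Lemma filterlim_euler_majorant_0 (c1 c2 a b : R) : 0 < b ->
  filterlim (euler_majorant_primitive c1 c2 a b) (at_right 0) (locally (- (c1 / a))).
Proof.
  intros Hb. replace (- (c1 / a)) with (- (c1 / a) * Rpower (1 - 0) a + c2 / b * 0).
  - refine (filterlim_plus_R _ _ _ _ _ _ _); refine (filterlim_scal_R _ _ _ _ _).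
    + apply (filterlim_at_right_continuous (fun u => Rpower (1 - u) a) 0).
      apply continuous_Rpower_1m. lra.
    + now apply filterlim_Rpower_0.
  - unfold Rpower. rewrite Rminus_0_r ln_1 !Rmult_0_r exp_0. ring.
Qed.

Lemma filterlim_euler_majorant_1 (c1 c2 a b : R) : 0 < a ->
  filterlim (euler_majorant_primitive c1 c2 a b) (at_left 1) (locally (c2 / b)).
Proof.
  intros Hb. replace (c2 / b) with (- (c1 / a) * 0 + c2 / b * Rpower 1 b).
  - refine (filterlim_plus_R _ _ _ _ _ _ _); refine (filterlim_scal_R _ _ _ _ _).
    + now apply filterlim_Rpower_0_left.
    + apply (filterlim_at_left_continuous (fun u => Rpower u b) 1).
      apply continuous_Rpower. lra.
  - unfold Rpower. rewrite ln_1 !Rmult_0_r exp_0. ring.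
Qed.

Lemma ex_RInt_gen_euler {V : CompleteNormedModule R_AbsRing} (a b c : R) (f : R -> V) :
  0 < a -> 0 < b -> (forall u, 0 < u < 1 -> continuous f u) ->
  (forall u, 0 < u < 1 -> norm (f u) <= c * euler_kernel a b u) ->
  ex_RInt_gen f (at_right 0) (at_left 1).
Proof.
  intros Ha Hb Hf Hc.
  set (k1 := exp (Rabs (b - 1) * ln 2)). set (k2 := exp (Rabs (a - 1) * ln 2)).
  (* The bound at u = 1/2, where the kernel is positive, forces c to be nonnegative. *)
  assert (Hc0 : 0 <= c).
  { assert (H := Hc (/ 2) ltac:(lra)). assert (H1 := norm_ge_0 (f (/ 2))).
    assert (H2 := euler_kernel_pos a b (/ 2)). nra. }
  apply (ex_RInt_gen_dominated (fun u => 0 < u < 1) f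
    (euler_majorant (c * k1) (c * k2) a b) (euler_majorant_primitive (c * k1) (c * k2) a b) (/ 2)
    (at_right 0) (at_left 1) (- (c * k1 / a)) (c * k2 / b)); auto.
  - apply convex_open.
  - lra.
  - intros; now apply continuous_euler_majorant.
  - intros; now apply is_derive_euler_majorant.
  - intros u Hu. apply Rle_trans with (1 := Hc u Hu). unfold euler_majorant.
    assert (H := euler_kernel_bound a b u Hu). fold k1 k2 in H. nra.
  - apply at_right_interval; lra.
  - apply at_left_interval; lra.
  - now apply filterlim_euler_majorant_0.
  - now apply filterlim_euler_majorant_1.
Qed.

Lemma is_RInt_gen_Beta (a b : R) : 0 < a -> 0 < b ->
  is_RInt_gen (euler_kernel a b) (at_right 0) (at_left 1) (Beta a b).
Proof.
  intros Ha Hb. apply (RInt_gen_correct (V := R_CompleteNormedModule)).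
  apply (ex_RInt_gen_euler a b 1); auto.
  - intros; now apply continuous_euler_kernel.
  - intros u Hu. rewrite Rmult_1_l. right. apply Rabs_pos_eq. left. apply euler_kernel_pos.
Qed.

Lemma Beta_pos (a b : R) : 0 < a -> 0 < b -> 0 < Beta a b.
Proof.
  intros Ha Hb.
  apply Rlt_le_trans with (RInt (euler_kernel a b) (/ 4) (/ 2)).
  - apply RInt_gt_0; [lra|intros; apply euler_kernel_pos|].
    intros; apply continuous_euler_kernel; lra.
  - apply (is_RInt_gen_ge_RInt (euler_kernel a b) (fun u => 0 < u < 1) (at_right 0) (at_left 1));
      try lra.
    + apply convex_open.
    + intros; now apply continuous_euler_kernel.
    + intros; left; apply euler_kernel_pos.
    + generalize (at_right_interval 0 (/ 4) ltac:(lra)). apply filter_imp. intros; lra.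
    + generalize (at_left_interval (/ 2) 1 ltac:(lra)). apply filter_imp. intros; lra.
    + now apply is_RInt_gen_Beta.
Qed.

Lemma Rpower_minus_1 (x a : R) : 0 < x -> Rpower x (a - 1) * x = Rpower x a.
Proof.
  intros Hx. rewrite -{2}(Rpower_1 x Hx) -Rpower_plus. f_equal. ring.
Qed.

(** Integrate the derivative of (1-u)^a u^b, which is b times the kernel of (a,b) minus a + b times
    that of (a,b+1); the function vanishes at both ends. *)
Lemma Beta_succ (a b : R) : 0 < a -> 0 < b -> (a + b) * Beta a (b + 1) = b * Beta a b.
Proof.
  intros Ha Hb.
  assert (H1 : is_RInt_gen (fun u => b * euler_kernel a b u - (a + b) * euler_kernel a (b + 1) u)
    (at_right 0) (at_left 1) (minus 0 0)).
  { apply (is_RInt_gen_derive (V := R_CompleteNormedModule) (fun u => 0 < u < 1)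
      (fun u => Rpower (1 - u) a * Rpower u b) _ (at_right 0) (at_left 1)).
    - apply convex_open.
    - intros u Hu. unfold euler_kernel.
      replace (b + 1 - 1) with b by ring.
      replace (b * (Rpower (1 - u) (a - 1) * Rpower u (b - 1)) -
               (a + b) * (Rpower (1 - u) (a - 1) * Rpower u b))
        with ((-1 * (a * Rpower (1 - u) (a - 1))) * Rpower u b +
               Rpower (1 - u) a * (b * Rpower u (b - 1))).
      2:{ rewrite -(Rpower_minus_1 (1 - u) a ltac:(lra)) -(Rpower_minus_1 u b ltac:(lra)). ring. }
      apply (is_derive_mult (K := R_AbsRing) (fun u => Rpower (1 - u) a) (fun u => Rpower u b)).
      + apply (is_derive_comp (V := R_NormedModule) (fun x => Rpower x a) (fun u => 1 - u)).
        * apply is_derive_Rpower. lra.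
        * auto_derive; auto; ring.
      + apply is_derive_Rpower. lra.
      + intros; apply Rmult_comm.
    - intros u Hu. apply (continuous_minus (V := R_NormedModule));
        apply (continuous_scal_r (V := R_NormedModule)); now apply continuous_euler_kernel.
    - apply at_right_interval; lra.
    - apply at_left_interval; lra.
    - replace 0 with (Rpower (1 - 0) a * 0) at 2 by ring.
      eapply (filterlim_comp_2 (fun u => Rpower (1 - u) a) (fun u => Rpower u b) Rmult).
      + apply (filterlim_at_right_continuous (fun u => Rpower (1 - u) a) 0).
        apply continuous_Rpower_1m. lra.
      + now apply filterlim_Rpower_0.
      + apply (filterlim_mult (K := R_AbsRing)).
    - replace 0 with (0 * Rpower 1 b) by ring.
      eapply (filterlim_comp_2 (fun u => Rpower (1 - u) a) (fun u => Rpower u b) Rmult).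
      + now apply filterlim_Rpower_0_left.
      + apply (filterlim_at_left_continuous (fun u => Rpower u b) 1).
        apply continuous_Rpower. lra.
      + apply (filterlim_mult (K := R_AbsRing)). }
  assert (H2 : is_RInt_gen (fun u => b * euler_kernel a b u - (a + b) * euler_kernel a (b + 1) u)
    (at_right 0) (at_left 1) (b * Beta a b - (a + b) * Beta a (b + 1))).
  { apply (is_RInt_gen_minus (V := R_NormedModule));
      apply (is_RInt_gen_scal (V := R_NormedModule)); apply is_RInt_gen_Beta; lra. }
  apply (is_RInt_gen_unique (V := R_CompleteNormedModule)) in H1.
  apply (is_RInt_gen_unique (V := R_CompleteNormedModule)) in H2.
  rewrite H1 in H2. unfold minus, plus, opp in H2; simpl in H2. lra.
Qed.

Lemma is_derive_primitive {V : CompleteNormedModule R_AbsRing} (f : R -> V) (c t : R) :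
  (forall s, 0 < s -> continuous f s) -> 0 < c -> 0 < t ->
  is_derive (RInt f c) t (f t).
Proof.
  intros Hf Hc Ht. apply (is_derive_RInt f (RInt f c) c t); [|now apply Hf].
  exists (mkposreal _ Ht). intros z Hz. apply (RInt_correct (V := V)).
  apply (ex_RInt_convex (fun s => 0 < s)); auto.
  - intros x y w; lra.
  - apply Rabs_def2 in Hz. unfold minus, plus, opp in Hz; simpl in Hz. lra.
Qed.

(** * The Gamma function *)

Definition gamma_integrand (a s : R) : R := Rpower s (a - 1) * exp (- s).

Lemma gamma_integrand_pos (a s : R) : 0 < gamma_integrand a s.
Proof. apply Rmult_lt_0_compat; [apply Rpower_pos|apply exp_pos]. Qed.

Lemma continuous_exp_opp (s : R) : continuous (fun s => exp (- s)) s.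
Proof.
  apply (continuous_comp Ropp exp); [apply (continuous_opp (V := R_NormedModule)), continuous_id|].
  apply continuous_exp.
Qed.

Lemma continuous_gamma_integrand (a s : R) : 0 < s -> continuous (gamma_integrand a) s.
Proof.
  intros Hs. apply (continuous_mult (K := R_AbsRing)).
  - now apply continuous_Rpower.
  - apply continuous_exp_opp.
Qed.

(** The constant is the maximum (p/e)^p of x^p exp(-x), attained at x = p; the bound is ln z <= z -
    1 at z = x/p. *)
Lemma Rpower_exp_bound (p x : R) : 0 < p -> 0 < x ->
  Rpower x p <= exp (p * ln p - p) * exp x.
Proof.
  intros Hp Hx. unfold Rpower. rewrite -exp_plus. apply exp_nondecreasing.
  assert (H : ln (x / p) <= x / p - 1).
  { assert (H := exp_ineq1_le (ln (x / p))). rewrite exp_ln in H; [lra|].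
    now apply Rdiv_lt_0_compat. }
  unfold Rdiv in H at 1. rewrite ln_mult in H; auto; [|now apply Rinv_0_lt_compat].
  rewrite ln_Rinv in H; auto.
  assert (H1 : p * (ln x + - ln p) <= p * (x / p - 1)) by (apply Rmult_le_compat_l; lra).
  replace (p * (x / p - 1)) with (x - p) in H1 by (field; lra). lra.
Qed.

(* s/(1+s) to the power a has derivative a s^(a-1) (1+s)^(-a-1), an integrable
   euler_majorant of s^(a-1) exp(-s) on the whole half-line. *)
Lemma gamma_primitive_limits (a : R) (c : R) : 0 < a -> 0 < c ->
  (exists l, filterlim (RInt (gamma_integrand a) c) (at_right 0) (locally l)) /\
  (exists l, filterlim (RInt (gamma_integrand a) c) (Rbar_locally p_infty) (locally l)).
Proof.
  intros Ha Hc.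
  (* [k] bounds (1+s)^(a+1) exp(-s): apply [Rpower_exp_bound] with exponent a + 1 at the point 1 +
     s; the shift by 1 produces the factor exp 1. *)
  set (k := exp ((a + 1) * ln (a + 1) - (a + 1)) * exp 1).
  set (g := fun s => k * (Rpower s (a - 1) * Rpower (1 + s) (- a - 1))).
  set (G := fun s => k / a * (Rpower s a * Rpower (1 + s) (- a))).
  assert (HP1 : forall p s, 0 < s -> is_derive (fun s => Rpower (1 + s) p) s
                  (1 * (p * Rpower (1 + s) (p - 1)))).
  { intros p s Hs.
    apply (is_derive_comp (V := R_NormedModule) (fun x => Rpower x p) (fun u => 1 + u)).
    - apply is_derive_Rpower. lra.
    - auto_derive; auto; ring. }
  assert (Hg : forall s, 0 < s -> continuous g s).
  { intros s Hs. apply (continuous_scal_r (V := R_NormedModule)).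
    apply (continuous_mult (K := R_AbsRing)); [now apply continuous_Rpower|].
    apply (ex_derive_continuous (V := R_NormedModule)). eexists. now apply HP1. }
  assert (HG : forall s, 0 < s -> is_derive G s (g s)).
  { intros s Hs. unfold G, g.
    replace (k * (Rpower s (a - 1) * Rpower (1 + s) (- a - 1))) with
      (k / a * ((a * Rpower s (a - 1)) * Rpower (1 + s) (- a)
                + Rpower s a * (1 * (- a * Rpower (1 + s) (- a - 1))))).
    - apply is_derive_scal.
      apply (is_derive_mult (K := R_AbsRing) (fun s => Rpower s a) (fun s => Rpower (1 + s) (- a))).
      + now apply is_derive_Rpower.
      + now apply HP1.
      + intros; apply Rmult_comm.
    - rewrite -(Rpower_minus_1 s a ltac:(lra)) -(Rpower_minus_1 (1 + s) (- a) ltac:(lra)). field. lra. }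
  assert (Hfg : forall s, 0 < s -> norm (gamma_integrand a s) <= g s).
  { intros s Hs. unfold norm; simpl. unfold abs; simpl.
    rewrite Rabs_pos_eq; [|left; apply gamma_integrand_pos].
    unfold g, gamma_integrand.
    assert (H1 := Rpower_exp_bound (a + 1) (1 + s) ltac:(lra) ltac:(lra)).
    rewrite exp_plus in H1. rewrite exp_Ropp.
    replace (- a - 1) with (- (a + 1)) by ring. rewrite Rpower_Ropp.
    rewrite -Rmult_assoc (Rmult_comm k) Rmult_assoc.
    apply Rmult_le_compat_l; [left; apply Rpower_pos|].
    fold k in H1. rewrite -Rmult_assoc in H1. fold k in H1.
    assert (H2 := Rpower_pos (1 + s) (a + 1)). assert (H3 := exp_pos s).
    apply Rmult_le_reg_r with (exp s); auto. apply Rmult_le_reg_r with (Rpower (1 + s) (a + 1)); auto.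
    rewrite Rinv_l; [|lra].
    replace (k * / Rpower (1 + s) (a + 1) * exp s * Rpower (1 + s) (a + 1)) with (k * exp s)
      by (field; lra). lra. }
  assert (HD : convex (fun s => 0 < s)) by (intros x y z; lra).
  assert (Hgc : forall s, 0 < s -> continuous (gamma_integrand a) s)
    by (intros; now apply continuous_gamma_integrand).
  split.
  - apply (dominated_primitive_limit (V := R_CompleteNormedModule) (fun s => 0 < s)
      (gamma_integrand a) g G c HD Hc Hgc Hg HG Hfg (at_right 0) 0).
    + generalize (at_right_interval 0 1 Rlt_0_1). apply filter_imp. tauto.
    + replace 0 with (k / a * (0 * Rpower (1 + 0) (- a))) at 2 by ring.
      refine (filterlim_scal_R _ _ _ _ _).
      eapply (filterlim_comp_2 (fun u => Rpower u a) (fun u => Rpower (1 + u) (- a)) Rmult).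
      * now apply filterlim_Rpower_0.
      * apply (filterlim_at_right_continuous (fun u => Rpower (1 + u) (- a)) 0).
        apply (continuous_comp (fun u => 1 + u) (fun x => Rpower x (- a))).
        -- apply (continuous_plus (V := R_NormedModule)); [apply continuous_const|apply continuous_id].
        -- apply continuous_Rpower. lra.
      * apply (filterlim_mult (K := R_AbsRing)).
  - apply (dominated_primitive_limit (V := R_CompleteNormedModule) (fun s => 0 < s)
      (gamma_integrand a) g G c HD Hc Hgc Hg HG Hfg (Rbar_locally p_infty) (k / a * Rpower 1 a)).
    + exists 0. auto.
    (* Writing s/(1+s) as 1 - 1/(1+s) reduces the limit at infinity to continuity of the power at
       1. *)
    + apply filterlim_ext_loc with (fun s => k / a * Rpower (1 - / (1 + s)) a).
      * exists 0. intros s Hs. apply (f_equal (Rmult (k / a))).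
        rewrite Rpower_Ropp. unfold Rpower.
        replace (1 - / (1 + s)) with (s * / (1 + s)) by (field; lra).
        rewrite ln_mult; auto; [|apply Rinv_0_lt_compat; lra].
        rewrite ln_Rinv; [|lra]. rewrite Rmult_plus_distr_l exp_plus. f_equal.
        rewrite -exp_Ropp. f_equal. ring.
      * refine (filterlim_scal_R _ _ _ _ _).
        eapply (filterlim_comp _ _ _ (fun s => 1 - / (1 + s)) (fun x => Rpower x a)).
        2: apply continuous_Rpower; lra.
        assert (E : filterlim (fun s => 1 + - / (1 + s)) (Rbar_locally p_infty)
          (locally (1 + - 0))).
        2: rewrite Ropp_0 Rplus_0_r in E; exact E.
        refine (filterlim_plus_R _ _ _ _ _ _ _); [apply filterlim_const|].
        apply (filterlim_comp _ _ _ (fun s => / (1 + s)) Ropp _ (locally 0)).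
        2: apply (filterlim_opp (V := R_NormedModule) 0).
        apply (proj2 (filterlim_norm_iff (V := R_NormedModule) _ _ _)). intros e He.
        exists (/ e). intros s Hs. unfold minus, plus, opp, norm; simpl. unfold abs; simpl.
        assert (0 < / e) by now apply Rinv_0_lt_compat.
        rewrite Ropp_0 Rplus_0_r Rabs_pos_eq.
        2: left; apply Rinv_0_lt_compat; lra.
        rewrite -(Rinv_inv e). apply Rinv_lt_contravar; [|lra].
        apply Rmult_lt_0_compat; lra.
Qed.

(** The lower incomplete Gamma function. It enters because J^a exp (t) equals exp(t)
    [lower_gamma a t] / Gamma(a). *)
Definition lower_gamma (a t : R) : R :=
  RInt_gen (gamma_integrand a) (at_right 0) (at_left t).

Lemma lower_gamma_correct (a t : R) : 0 < a -> 0 < t ->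
  is_RInt_gen (gamma_integrand a) (at_right 0) (at_left t) (lower_gamma a t).
Proof.
  intros Ha Ht. apply (RInt_gen_correct (V := R_CompleteNormedModule)).
  destruct (gamma_primitive_limits a t Ha Ht) as [[l Hl] _].
  exists (minus (RInt (gamma_integrand a) t t) l).
  apply (is_RInt_gen_RInt_primitive (V := R_CompleteNormedModule) (fun s => 0 < s)
    (gamma_integrand a) t (at_right 0) (at_left t)); auto.
  - intros x y z; lra.
  - intros; now apply continuous_gamma_integrand.
  - generalize (at_right_interval 0 1 Rlt_0_1). apply filter_imp. tauto.
  - generalize (at_left_interval 0 t Ht). apply filter_imp. tauto.
  - apply filterlim_at_left_continuous.
    apply (ex_derive_continuous (V := R_NormedModule)). eexists.
    apply (is_derive_primitive (V := R_CompleteNormedModule)); auto.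
    intros; now apply continuous_gamma_integrand.
Qed.

Lemma is_RInt_gen_Gamma (a : R) : 0 < a ->
  is_RInt_gen (gamma_integrand a) (at_right 0) (Rbar_locally p_infty) (Gamma a).
Proof.
  intros Ha. apply (RInt_gen_correct (V := R_CompleteNormedModule)).
  destruct (gamma_primitive_limits a 1 Ha Rlt_0_1) as [[l Hl] [l' Hl']].
  exists (minus l' l).
  apply (is_RInt_gen_RInt_primitive (V := R_CompleteNormedModule) (fun s => 0 < s)
    (gamma_integrand a) 1 (at_right 0) (Rbar_locally p_infty)); auto.
  - intros x y z; lra.
  - lra.
  - intros; now apply continuous_gamma_integrand.
  - generalize (at_right_interval 0 1 Rlt_0_1). apply filter_imp. tauto.
  - exists 0. auto.
Qed.

Lemma Gamma_pos (a : R) : 0 < a -> 0 < Gamma a.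
Proof.
  intros Ha.
  apply Rlt_le_trans with (RInt (gamma_integrand a) 1 2).
  - apply RInt_gt_0; [lra|intros; apply gamma_integrand_pos|].
    intros; apply continuous_gamma_integrand; lra.
  - apply (is_RInt_gen_ge_RInt (gamma_integrand a) (fun u => 0 < u) (at_right 0)
      (Rbar_locally p_infty)); try lra.
    + intros x y z; lra.
    + intros; now apply continuous_gamma_integrand.
    + intros; left; apply gamma_integrand_pos.
    + generalize (at_right_interval 0 1 ltac:(lra)). apply filter_imp. intros; lra.
    + exists 2. intros; lra.
    + now apply is_RInt_gen_Gamma.
Qed.

(** Basing the primitive at 1 instead of 0 turns differences of [lower_gamma] into proper integrals;
    [l] is minus the integral over (0,1). *)
Lemma lower_gamma_primitive (a : R) : 0 < a ->
  exists l, (forall t, 0 < t -> lower_gamma a t = RInt (gamma_integrand a) 1 t - l) /\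
    filterlim (RInt (gamma_integrand a) 1) (Rbar_locally p_infty) (locally (Gamma a + l)).
Proof.
  intros Ha.
  destruct (gamma_primitive_limits a 1 Ha Rlt_0_1) as [[l Hl] [l' Hl']].
  assert (HD : convex (fun s => 0 < s)) by (intros x y z; lra).
  assert (Hgc : forall s, 0 < s -> continuous (gamma_integrand a) s)
    by (intros; now apply continuous_gamma_integrand).
  assert (H0 : at_right 0 (fun s => 0 < s)).
  { generalize (at_right_interval 0 1 Rlt_0_1). apply filter_imp. tauto. }
  exists l. split.
  - intros t Ht.
    refine (is_RInt_gen_unique (V := R_CompleteNormedModule) (gamma_integrand a) _ _).
    apply (is_RInt_gen_RInt_primitive (V := R_CompleteNormedModule) (fun s => 0 < s)
      (gamma_integrand a) 1 (at_right 0) (at_left t)); auto.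
    + lra.
    + generalize (at_left_interval 0 t Ht). apply filter_imp. tauto.
    + apply filterlim_at_left_continuous.
      apply (ex_derive_continuous (V := R_NormedModule)). eexists.
      apply (is_derive_primitive (V := R_CompleteNormedModule)); auto; lra.
  - assert (HG := is_RInt_gen_RInt_primitive (V := R_CompleteNormedModule) (fun s => 0 < s)
      (gamma_integrand a) 1 (at_right 0) (Rbar_locally p_infty) l l'
      HD Rlt_0_1 Hgc H0 ltac:(exists 0; auto) Hl Hl').
    replace (Gamma a + l) with l'; auto.
    assert (E : Gamma a = l' - l).
    { exact (is_RInt_gen_unique (V := R_CompleteNormedModule) (gamma_integrand a) _ HG). }
    lra.
Qed.

Lemma lower_gamma_lim (a : R) : 0 < a ->
  filterlim (lower_gamma a) (Rbar_locally p_infty) (locally (Gamma a)).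
Proof.
  intros Ha. destruct (lower_gamma_primitive a Ha) as [l [H1 H2]].
  apply filterlim_ext_loc with (fun t => RInt (gamma_integrand a) 1 t + - l).
  - exists 0. intros t Ht. now rewrite (H1 t Ht).
  - replace (Gamma a) with (Gamma a + l + - l) by ring.
    refine (filterlim_plus_R _ _ _ _ _ _ _); auto. apply filterlim_const.
Qed.

Lemma lower_gamma_ge_0 (a t : R) : 0 < a -> 0 < t -> 0 <= lower_gamma a t.
Proof.
  (* Zero is written as an integral over a degenerate interval, so that the comparison with proper
     integrals applies. *)
  intros Ha Ht. replace 0 with (RInt (gamma_integrand a) (t / 2) (t / 2))
    by exact (RInt_point (V := R_CompleteNormedModule) _ _).
  apply (is_RInt_gen_ge_RInt (gamma_integrand a) (fun s => 0 < s < t) (at_right 0) (at_left t));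
    try lra.
  - apply convex_open.
  - intros; apply continuous_gamma_integrand; lra.
  - intros; left; apply gamma_integrand_pos.
  - generalize (at_right_interval 0 (t / 2) ltac:(lra)). apply filter_imp. intros; lra.
  - generalize (at_left_interval (t / 2) t ltac:(lra)). apply filter_imp. intros; lra.
  - now apply lower_gamma_correct.
Qed.

Lemma lower_gamma_incr (a s t : R) : 0 < a -> 0 < s <= t ->
  lower_gamma a s <= lower_gamma a t.
Proof.
  intros Ha Hs. destruct (lower_gamma_primitive a Ha) as [l [H1 _]].
  rewrite !H1; try lra.
  assert (E : forall u v, 0 < u -> 0 < v -> ex_RInt (gamma_integrand a) u v).
  { intros u v Hu Hv.
    apply (ex_RInt_convex (V := R_CompleteNormedModule) (fun s => 0 < s)).
    - intros x y z; lra.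
    - intros; now apply continuous_gamma_integrand.
    - exact Hu.
    - exact Hv. }
  assert (E0 := E s t ltac:(lra) ltac:(lra)).
  assert (E1 := RInt_Chasles (V := R_CompleteNormedModule) (gamma_integrand a) 1 s t
    (E 1 s ltac:(lra) ltac:(lra)) E0).
  unfold plus in E1; simpl in E1.
  assert (0 <= RInt (gamma_integrand a) s t); [|lra].
  apply RInt_ge_0; auto; [lra|]. intros; left; apply gamma_integrand_pos.
Qed.

Lemma lower_gamma_le (a t : R) : 0 < a -> 0 < t -> lower_gamma a t <= Gamma a.
Proof.
  intros Ha Ht.
  apply (filterlim_le (F := Rbar_locally p_infty) (fun _ => lower_gamma a t) (lower_gamma a)
    (lower_gamma a t) (Gamma a)).
  - exists t. intros x Hx. apply lower_gamma_incr; lra.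
  - apply filterlim_const.
  - now apply lower_gamma_lim.
Qed.

Lemma Gamma_1 : Gamma 1 = 1.
Proof.
  assert (H : is_RInt_gen (gamma_integrand 1) (at_right 0) (Rbar_locally p_infty)
    (minus (-0) (- exp (- 0)))).
  2:{ apply (is_RInt_gen_unique (V := R_CompleteNormedModule)) in H.
      unfold Gamma. unfold gamma_integrand in H. rewrite H.
      unfold minus, plus, opp; simpl. rewrite !Ropp_0 exp_0. ring. }
  apply (is_RInt_gen_derive (V := R_CompleteNormedModule) (fun s => 0 < s)
    (fun s => - exp (- s)) _ (at_right 0) (Rbar_locally p_infty)).
  - intros x y z; lra.
  - intros s Hs. unfold gamma_integrand.
    replace (Rpower s (1 - 1) * exp (- s)) with (- (- 1 * exp (- s))).
    + auto_derive; auto.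
    + rewrite Rminus_diag Rpower_O; [|lra]. ring.
  - intros s Hs. apply (continuous_gamma_integrand 1 s Hs).
  - generalize (at_right_interval 0 1 Rlt_0_1). apply filter_imp. tauto.
  - exists 0. auto.
  - apply (filterlim_at_right_continuous (fun s => - exp (- s)) 0).
    apply (continuous_opp (V := R_NormedModule)). apply continuous_exp_opp.
  - apply (filterlim_comp _ _ _ (fun s => exp (- s)) Ropp _ (locally 0)).
    2: apply (filterlim_opp (V := R_NormedModule) 0).
    apply (proj2 (filterlim_norm_iff (V := R_NormedModule) _ _ _)). intros e He.
    exists (/ e). intros s Hs. unfold minus, plus, opp, norm; simpl. unfold abs; simpl.
    assert (He' : 0 < / e) by now apply Rinv_0_lt_compat.
    rewrite Ropp_0 Rplus_0_r Rabs_pos_eq; [|left; apply exp_pos].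
    rewrite exp_Ropp -(Rinv_inv e). apply Rinv_lt_contravar.
    + apply Rmult_lt_0_compat; auto. apply exp_pos.
    + assert (H := exp_ineq1_le s). lra.
Qed.

(** * Bernstein approximation *)

(** The sum of binomial(n,k) u^k (1-u)^(n-k) c(k), computed by de Casteljau's recursion.
    Conditioning on one Bernoulli trial makes the variance bound and the algebraic properties plain
    inductions. *)
Fixpoint bernstein {V : NormedModule R_AbsRing} (n : nat) (c : nat -> V) (u : R) : V :=
  match n with
  | O => c O
  | S n => plus (scal (1 - u) (bernstein n c u)) (scal u (bernstein n (fun k => c (S k)) u))
  end.

(* The right-hand side is e + L E[(K - x)^2] for K binomial of parameters n and u. *)
Lemma bernstein_dist {V : NormedModule R_AbsRing} (n : nat) (c : nat -> V) (v : V)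
    (u e L x : R) :
  0 <= u <= 1 ->
  (forall k, (k <= n)%nat -> norm (minus (c k) v) <= e + L * (INR k - x) ^ 2) ->
  norm (minus (bernstein n c u) v) <= e + L * ((INR n * u - x) ^ 2 + INR n * u * (1 - u)).
Proof.
  intros Hu. revert c x. induction n as [|n IH]; intros c x Hc.
  - simpl bernstein. eapply Rle_trans; [apply Hc; lia|]. simpl INR. right. ring.
  - simpl bernstein.
    (* A failed trial leaves the centre x in place; a successful one shifts the coefficients, which
       moves the centre to x - 1. *)
    assert (H1 := IH c x (fun k Hk => Hc k ltac:(lia))).
    assert (H2 := IH (fun k => c (S k)) (x - 1)).
    assert (H2' : forall k, (k <= n)%nat ->
      norm (minus (c (S k)) v) <= e + L * (INR k - (x - 1)) ^ 2).
    { intros k Hk. replace (INR k - (x - 1)) with (INR (S k) - x) by (rewrite S_INR; ring).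
      apply Hc. lia. }
    specialize (H2 H2').
    set (p := bernstein n c u) in *. set (q := bernstein n (fun k => c (S k)) u) in *.
    assert (E : minus (plus (scal (1 - u) p) (scal u q)) v
      = plus (scal (1 - u) (minus p v)) (scal u (minus q v))).
    { unfold minus. rewrite !scal_distr_l.
      assert (Ev : opp v = plus (scal (1 - u) (opp v)) (scal u (opp v))).
      { rewrite -scal_distr_r. transitivity (scal (@one R_Ring) (opp v)).
        - symmetry. exact (scal_one (opp v)).
        - f_equal. unfold plus, one; simpl. ring. }
      etransitivity; [exact (f_equal (plus _) Ev)|]. exact (plus_interchange _ _ _ _). }
    eapply Rle_trans; [right; exact (f_equal norm E)|].
    eapply Rle_trans; [refine (norm_triangle (V := V) _ _)|].
    rewrite !norm_scal_R (Rabs_pos_eq (1 - u)) ?(Rabs_pos_eq u); try lra.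
    apply Rle_trans with ((1 - u) * (e + L * ((INR n * u - x) ^ 2 + INR n * u * (1 - u)))
        + u * (e + L * ((INR n * u - (x - 1)) ^ 2 + INR n * u * (1 - u)))).
    + apply Rplus_le_compat; apply Rmult_le_compat_l; lra.
    + right. change (match n with O => 1 | S _ => INR n + 1 end) with (INR (S n)).
      rewrite S_INR. ring.
Qed.

(** Chebyshev's argument: coefficients with k/n near u differ from phi(u) by less than e/2 by
    uniform continuity. The others differ by at most 2 S, which L (k/n - u)^2 dominates. The
    variance of k/n is u (1-u) / n. *)
Lemma bernstein_approx {V : NormedModule R_AbsRing} (phi : R -> V) (e : R) :
  (forall r, continuous phi r) -> 0 < e ->
  exists n (c : nat -> V), forall u, 0 <= u <= 1 ->
    norm (minus (bernstein n c u) (phi u)) <= e.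
Proof.
  intros Hphi He.
  destruct (bounded_continuity phi 0 1 (fun x _ => Hphi x)) as [S HS].
  assert (He2 : 0 < e / 2) by lra.
  destruct (unifcont_normed_1d phi 0 1 (fun x _ => Hphi x) (mkposreal _ He2)) as [d Hd].
  assert (Hd0 := cond_pos d). set (dd := pos d) in *.
  assert (HS0 : 0 <= S).
  { apply Rle_trans with (norm (phi 0)); [apply norm_ge_0|]. left. apply HS. lra. }
  set (L := 2 * S / dd ^ 2).
  assert (HL : 0 <= L).
  { unfold L. apply Rdiv_le_0_compat; [lra|apply pow_lt; lra]. }
  destruct (nfloor_ex (L / e) (Rdiv_le_0_compat _ _ HL He)) as [m Hm].
  set (n := Datatypes.S m).
  (* Since u (1-u) <= 1/2, this n leaves at most e/2 for the variance term. *)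
  assert (Hn : L / e < INR n) by (unfold n; rewrite S_INR; lra).
  assert (Hn0 : 0 < INR n) by (apply lt_0_INR; unfold n; lia).
  exists n, (fun k => phi (INR k / INR n)). intros u Hu.
  eapply Rle_trans.
  - apply (bernstein_dist n (fun k => phi (INR k / INR n)) (phi u) u (e / 2) (L / INR n ^ 2) (INR n * u));
      auto.
    intros k Hk. assert (Hk' : INR k <= INR n) by now apply le_INR.
    assert (Hk0 := pos_INR k).
    assert (Hkn : 0 <= INR k / INR n <= 1).
    { split; [apply Rdiv_le_0_compat; lra|]. apply Rmult_le_reg_r with (INR n); auto.
      unfold Rdiv. rewrite Rmult_assoc Rinv_l; lra. }
    replace (L / INR n ^ 2 * (INR k - INR n * u) ^ 2) with (L * (INR k / INR n - u) ^ 2)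
      by (field; lra).
    destruct (Rlt_le_dec (Rabs (INR k / INR n - u)) dd) as [Hlt|Hge].
    + assert (H := Hd u (INR k / INR n) Hu Hkn Hlt).
      change (norm (minus (phi (INR k / INR n)) (phi u)) < e / 2) in H.
      assert (0 <= L * (INR k / INR n - u) ^ 2); [|lra].
      apply Rmult_le_pos; auto. apply pow2_ge_0.
    + assert (H1 := HS _ Hkn). assert (H2 := HS _ Hu).
      assert (H3 : norm (minus (phi (INR k / INR n)) (phi u)) <= 2 * S).
      { eapply Rle_trans; [refine (norm_triangle (V := V) _ _)|]. rewrite norm_opp. lra. }
      apply Rle_trans with (1 := H3).
      assert (H4 : dd ^ 2 <= (INR k / INR n - u) ^ 2).
      { rewrite -(pow2_abs (INR k / INR n - u)). apply pow_incr. lra. }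
      assert (H5 : L * dd ^ 2 <= L * (INR k / INR n - u) ^ 2) by now apply Rmult_le_compat_l.
      replace (L * dd ^ 2) with (2 * S) in H5; [lra|]. unfold L. field. lra.
  - replace (L / INR n ^ 2 * ((INR n * u - INR n * u) ^ 2 + INR n * u * (1 - u)))
      with (L / INR n * (u * (1 - u))) by (field; lra).
    assert (H1 : L / INR n <= e).
    { apply Rmult_le_reg_r with (INR n); auto. unfold Rdiv. rewrite Rmult_assoc Rinv_l; [|lra].
      assert (H := Rmult_lt_compat_r e _ _ He Hn).
      replace (L / e * e) with L in H by (field; lra). lra. }
    assert (H2 := Rdiv_le_0_compat _ _ HL Hn0).
    assert (H3 : 0 <= u * (1 - u) <= / 2) by nra. nra.
Qed.

(** * Weighted dilation means *)

Section EulerMean.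

Context {V : CompleteNormedModule R_AbsRing}.

(* J^a (r^(b-1) phi) (t) = t^(a+b-1) / Gamma(a) times this mean. *)
Definition euler_mean (a b : R) (phi : R -> V) (t : R) : V :=
  RInt_gen (fun u => scal (euler_kernel a b u) (phi (t * u))) (at_right 0) (at_left 1).

Lemma continuous_dilation (phi : R -> V) (t u : R) :
  (forall r, continuous phi r) -> continuous (fun u => phi (t * u)) u.
Proof.
  intros H. apply (continuous_comp (fun u => t * u) phi); [|apply H].
  apply (continuous_scal_r (V := R_NormedModule)). apply continuous_id.
Qed.

Lemma continuous_euler_scal (a b : R) (phi : R -> V) (u : R) :
  (forall r, continuous phi r) -> 0 < u < 1 ->
  continuous (fun u => scal (euler_kernel a b u) (phi u)) u.
Proof.
  intros H Hu. apply (continuous_scal (V := V)); [|apply H]. now apply continuous_euler_kernel.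
Qed.

Lemma norm_euler_scal (a b : R) (x : V) (u : R) :
  norm (scal (euler_kernel a b u) x) = euler_kernel a b u * norm x.
Proof.
  rewrite norm_scal_R Rabs_pos_eq; auto.
  left. apply euler_kernel_pos.
Qed.

Lemma is_RInt_gen_euler_mean (a b : R) (phi : R -> V) (t : R) : 0 < a -> 0 < b ->
  (forall r, continuous phi r) ->
  is_RInt_gen (fun u => scal (euler_kernel a b u) (phi (t * u))) (at_right 0) (at_left 1)
    (euler_mean a b phi t).
Proof.
  intros Ha Hb H. apply RInt_gen_correct.
  assert (H' : forall r, continuous (fun u => phi (t * u)) r)
    by (intros; now apply continuous_dilation).
  destruct (bounded_continuity (fun u => phi (t * u)) 0 1 (fun x _ => H' x)) as [S HS].
  apply (ex_RInt_gen_euler a b S); auto.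
  - intros u Hu. now apply (continuous_euler_scal a b (fun u => phi (t * u))).
  - intros u Hu. rewrite norm_euler_scal. rewrite Rmult_comm. apply Rmult_le_compat_r.
    + left; apply euler_kernel_pos.
    + left; apply HS; lra.
Qed.

Lemma norm_euler_mean_le (a b : R) (phi : R -> V) (t c : R) : 0 < a -> 0 < b ->
  (forall r, continuous phi r) -> (forall u, 0 < u < 1 -> norm (phi (t * u)) <= c) ->
  norm (euler_mean a b phi t) <= c * Beta a b.
Proof.
  intros Ha Hb H Hc.
  apply (RInt_gen_norm (Fa := at_right 0) (Fb := at_left 1)
    (fun u => scal (euler_kernel a b u) (phi (t * u))) (fun u => c * euler_kernel a b u)).
  - apply Filter_prod with (1 := at_right_interval 0 (/ 2) ltac:(lra))
      (2 := at_left_interval (/ 2) 1 ltac:(lra)). simpl. intros; lra.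
  - apply Filter_prod with (1 := at_right_interval 0 (/ 2) ltac:(lra))
      (2 := at_left_interval (/ 2) 1 ltac:(lra)). simpl. intros x y Hx Hy u Hu.
    rewrite norm_euler_scal Rmult_comm. apply Rmult_le_compat_r.
    + left; apply euler_kernel_pos.
    + apply Hc; lra.
  - now apply is_RInt_gen_euler_mean.
  - apply (is_RInt_gen_scal (V := R_NormedModule)). now apply is_RInt_gen_Beta.
Qed.

Lemma euler_mean_plus (a b : R) (phi psi : R -> V) (t : R) : 0 < a -> 0 < b ->
  (forall r, continuous phi r) -> (forall r, continuous psi r) ->
  euler_mean a b (fun r => plus (phi r) (psi r)) t =
  plus (euler_mean a b phi t) (euler_mean a b psi t).
Proof.
  intros Ha Hb H1 H2.
  refine (is_RInt_gen_unique (V := V) (fun u => scal (euler_kernel a b u) (plus (phi (t * u)) (psi (t * u)))) _ _).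
  replace (fun u => scal (euler_kernel a b u) (plus (phi (t * u)) (psi (t * u))))
    with (fun u => plus (scal (euler_kernel a b u) (phi (t * u))) (scal (euler_kernel a b u) (psi (t * u)))).
  - apply (is_RInt_gen_plus (V := V)); now apply is_RInt_gen_euler_mean.
  - apply functional_extensionality. intros u. now rewrite scal_distr_l.
Qed.

Lemma euler_mean_scal (a b k : R) (phi : R -> V) (t : R) : 0 < a -> 0 < b ->
  (forall r, continuous phi r) ->
  euler_mean a b (fun r => scal k (phi r)) t = scal k (euler_mean a b phi t).
Proof.
  intros Ha Hb H1.
  refine (is_RInt_gen_unique (V := V) (fun u => scal (euler_kernel a b u) (scal k (phi (t * u)))) _ _).
  replace (fun u => scal (euler_kernel a b u) (scal k (phi (t * u))))
    with (fun u => scal k (scal (euler_kernel a b u) (phi (t * u)))).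
  - apply (is_RInt_gen_scal (V := V)); now apply is_RInt_gen_euler_mean.
  - apply functional_extensionality. intros u. rewrite !scal_assoc. f_equal. apply Rmult_comm.
Qed.

Lemma euler_mean_opp (a b : R) (phi : R -> V) (t : R) : 0 < a -> 0 < b ->
  (forall r, continuous phi r) ->
  euler_mean a b (fun r => opp (phi r)) t = opp (euler_mean a b phi t).
Proof.
  intros Ha Hb H. rewrite -scal_opp_one -euler_mean_scal //.
  unfold euler_mean. f_equal. apply functional_extensionality. intros u.
  now rewrite scal_opp_one.
Qed.

Lemma continuous_opp_fun (phi : R -> V) :
  (forall r, continuous phi r) -> (forall r, continuous (fun r => opp (phi r)) r).
Proof. intros H r. now apply (continuous_opp (V := V)). Qed.

Lemma euler_mean_minus (a b : R) (phi psi : R -> V) (t : R) : 0 < a -> 0 < b ->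
  (forall r, continuous phi r) -> (forall r, continuous psi r) ->
  euler_mean a b (fun r => minus (phi r) (psi r)) t =
  minus (euler_mean a b phi t) (euler_mean a b psi t).
Proof.
  intros Ha Hb H1 H2. unfold minus. rewrite euler_mean_plus //.
  - now rewrite euler_mean_opp.
  - now apply continuous_opp_fun.
Qed.

(** The difference of the means at s and t is the mean of phi(s u) - phi(t u), and |s u - t u| <= |s
    - t|; uniform continuity of phi on a compact interval finishes. *)
Lemma continuous_euler_mean (a b : R) (phi : R -> V) (t : R) : 0 < a -> 0 < b ->
  (forall r, continuous phi r) -> continuous (euler_mean a b phi) t.
Proof.
  intros Ha Hb H. apply (proj2 (filterlim_norm_iff (V := V) _ _ _)). intros e He.
  assert (HB := Beta_pos a b Ha Hb).
  assert (He' : 0 < e / (2 * Beta a b)) by (apply Rdiv_lt_0_compat; lra).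
  (* All products s u and t u stay in [-T, T] once |s - t| < 1. *)
  set (T := Rabs t + 1).
  destruct (unifcont_normed_1d phi (- T) T (fun x _ => H x) (mkposreal _ He')) as [d Hd].
  assert (Hd0 := cond_pos d).
  assert (Hm : 0 < Rmin d 1) by (apply Rmin_pos; lra).
  exists (mkposreal _ Hm). intros s Hs. simpl in Hs.
  assert (Hs' : Rabs (s - t) < Rmin d 1) by exact Hs. clear Hs.
  assert (Hs1 := Rlt_le_trans _ _ _ Hs' (Rmin_l _ _)).
  assert (Hs2 := Rlt_le_trans _ _ _ Hs' (Rmin_r _ _)).
  assert (HT : forall r u, Rabs r <= T -> 0 < u < 1 -> - T <= r * u <= T).
  { intros r u Hr Hu. apply Rabs_le_between. rewrite Rabs_mult (Rabs_pos_eq u); [|lra].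
    assert (H0 := Rabs_pos r). nra. }
  assert (Ht : Rabs t <= T) by (unfold T; lra).
  assert (HsT : Rabs s <= T).
  { unfold T. replace s with ((s - t) + t) by ring. eapply Rle_trans; [apply Rabs_triang|]. lra. }
  assert (E : minus (euler_mean a b phi s) (euler_mean a b phi t) =
              euler_mean a b (fun u => minus (phi (s * u)) (phi (t * u))) 1).
  { rewrite (euler_mean_minus a b (fun u => phi (s * u)) (fun u => phi (t * u)) 1) //;
      try (intros; now apply continuous_dilation).
    unfold euler_mean. f_equal; [|f_equal]; f_equal; apply functional_extensionality; intros u;
      now rewrite Rmult_1_l. }
  rewrite E.
  apply Rle_lt_trans with (e / (2 * Beta a b) * Beta a b).
  - apply norm_euler_mean_le; auto.
    + intros r. apply (continuous_minus (V := V)); now apply continuous_dilation.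
    + intros u Hu. rewrite Rmult_1_l. left.
      refine (Hd (t * u) (s * u) (HT _ _ Ht Hu) (HT _ _ HsT Hu) _).
      change (Rabs (s * u - t * u) < d). rewrite -Rmult_minus_distr_r Rabs_mult (Rabs_pos_eq u); [|lra].
      assert (H0 := Rabs_pos (s - t)). nra.
  - replace (e / (2 * Beta a b) * Beta a b) with (e / 2) by (field; lra). lra.
Qed.

Lemma euler_kernel_pow (a b u : R) (k : nat) : 0 < u ->
  euler_kernel a b u * u ^ k = euler_kernel a (b + INR k) u.
Proof.
  intros Hu. unfold euler_kernel. rewrite -Rpower_pow // Rmult_assoc -Rpower_plus.
  do 2 f_equal. ring.
Qed.

(** Multiplication by u^k only moves the second parameter of the kernel, so the mean is diagonal on
    monomials, with eigenvalue [Beta a (b + INR k)]. *)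
Lemma euler_mean_monomial (a b : R) (k : nat) (x : V) (t : R) : 0 < a -> 0 < b ->
  euler_mean a b (fun r => scal (r ^ k) x) t = scal (t ^ k * Beta a (b + INR k)) x.
Proof.
  intros Ha Hb.
  refine (is_RInt_gen_unique (V := V) (fun u => scal (euler_kernel a b u) (scal ((t * u) ^ k) x)) _ _).
  assert (Hk := pos_INR k).
  assert (Hbk : 0 < b + INR k) by lra.
  assert (H := is_RInt_gen_scal (V := R_NormedModule) _ (t ^ k) _
    (is_RInt_gen_Beta a (b + INR k) Ha Hbk)).
  assert (H' := is_RInt_gen_linear (fun r : R_NormedModule => scal r x) _
    (at_right 0) (at_left 1) _ (is_linear_scal_l x) H).
  revert H'. apply (is_RInt_gen_ext (V := V) (Fa := at_right 0) (Fb := at_left 1)).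
  apply Filter_prod with (1 := at_right_interval 0 (/ 2) ltac:(lra))
      (2 := at_left_interval (/ 2) 1 ltac:(lra)). simpl. intros v w Hv Hw u Hu.
  rewrite Rmin_left in Hu; [|lra]. rewrite scal_assoc. f_equal.
  rewrite -euler_kernel_pow; [|lra]. rewrite Rpow_mult_distr. unfold scal, mult; simpl.
  unfold mult; simpl. ring.
Qed.

Lemma euler_mean_const (a b : R) (x : V) (t : R) : 0 < a -> 0 < b ->
  euler_mean a b (fun _ => x) t = scal (Beta a b) x.
Proof.
  intros Ha Hb. assert (H := euler_mean_monomial a b 0 x t Ha Hb). simpl in H.
  rewrite Rplus_0_r Rmult_1_l in H. rewrite -H. unfold euler_mean. f_equal.
  apply functional_extensionality. intros u. f_equal. symmetry. exact (scal_one x).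
Qed.

(** * Composition of means *)

(** The ratio of the two sides of the semigroup law on constant phi, with the Gamma normalisations
    removed. Its value is Gamma(a) Gamma(b) / Gamma(a+b), as [compose_factor_Gamma] shows. *)
Definition compose_factor (a b c : R) : R := Beta b c * Beta a (b + c) / Beta (a + b) c.

(** From k to k + 1, with z = c + k, the left side gains z/(b+z) times (b+z)/(a+b+z), and the right
    side gains z/(a+b+z): the same factor. *)
Lemma compose_factor_shift (a b c : R) (k : nat) : 0 < a -> 0 < b -> 0 < c ->
  Beta b (c + INR k) * Beta a (b + c + INR k) = compose_factor a b c * Beta (a + b) (c + INR k).
Proof.
  intros Ha Hb Hc. induction k as [|k IH].
  - simpl INR. rewrite !Rplus_0_r. unfold compose_factor. field.
    apply Rgt_not_eq, Beta_pos; lra.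
  - rewrite S_INR. assert (Hk := pos_INR k). set (z := c + INR k) in *.
    assert (Hz : 0 < z) by (unfold z; lra).
    replace (c + (INR k + 1)) with (z + 1) by (unfold z; ring).
    replace (b + c + (INR k + 1)) with (b + z + 1) by (unfold z; ring).
    replace (b + c + INR k) with (b + z) in IH by (unfold z; ring).
    assert (E1 := Beta_succ b z Hb Hz).
    assert (E2 := Beta_succ a (b + z) Ha ltac:(lra)).
    assert (E3 := Beta_succ (a + b) z ltac:(lra) Hz).
    replace (Beta b (z + 1)) with (z * Beta b z / (b + z)) by (rewrite -E1; field; lra).
    replace (Beta a (b + z + 1)) with ((b + z) * Beta a (b + z) / (a + (b + z)))
      by (rewrite -E2; field; lra).
    replace (Beta (a + b) (z + 1)) with (z * Beta (a + b) z / (a + b + z))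
      by (rewrite -E3; field; lra).
    replace (z * Beta b z / (b + z) * ((b + z) * Beta a (b + z) / (a + (b + z))))
      with (z / (a + b + z) * (Beta b z * Beta a (b + z))) by (field; lra).
    rewrite IH. field. lra.
Qed.

(** At t = 1 only the values of phi on [0,1] enter, which is where Bernstein approximation is
    uniform. Every other t follows by dilation, which commutes with the means. *)
Definition mean_compose_at_1 (a b c : R) (phi : R -> V) : Prop :=
  euler_mean a (b + c) (euler_mean b c phi) 1 =
  scal (compose_factor a b c) (euler_mean (a + b) c phi 1).

Lemma mean_compose_monomial (a b c : R) (k : nat) (x : V) : 0 < a -> 0 < b -> 0 < c ->
  mean_compose_at_1 a b c (fun u => scal (u ^ k) x).
Proof.
  intros Ha Hb Hc. unfold mean_compose_at_1.
  replace (euler_mean b c (fun u => scal (u ^ k) x))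
    with (fun t => scal (t ^ k) (scal (Beta b (c + INR k)) x)).
  2:{ apply functional_extensionality. intros t. rewrite euler_mean_monomial //.
      now rewrite scal_assoc. }
  rewrite !euler_mean_monomial //; try lra. rewrite !scal_assoc. f_equal.
  unfold mult; simpl. rewrite pow1 !Rmult_1_l -compose_factor_shift //. ring.
Qed.

Lemma mean_compose_plus (a b c : R) (phi psi : R -> V) : 0 < a -> 0 < b -> 0 < c ->
  (forall r, continuous phi r) -> (forall r, continuous psi r) ->
  mean_compose_at_1 a b c phi -> mean_compose_at_1 a b c psi ->
  mean_compose_at_1 a b c (fun r => plus (phi r) (psi r)).
Proof.
  unfold mean_compose_at_1. intros Ha Hb Hc H1 H2 E1 E2.
  replace (euler_mean b c (fun r => plus (phi r) (psi r)))
    with (fun t => plus (euler_mean b c phi t) (euler_mean b c psi t)).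
  2:{ apply functional_extensionality. intros t. now rewrite euler_mean_plus. }
  rewrite !euler_mean_plus //; try lra; try (intros; now apply continuous_euler_mean).
  now rewrite scal_distr_l E1 E2.
Qed.

Lemma mean_compose_opp (a b c : R) (phi : R -> V) : 0 < a -> 0 < b -> 0 < c ->
  (forall r, continuous phi r) ->
  mean_compose_at_1 a b c phi -> mean_compose_at_1 a b c (fun r => opp (phi r)).
Proof.
  unfold mean_compose_at_1. intros Ha Hb Hc H1 E1.
  replace (euler_mean b c (fun r => opp (phi r))) with (fun t => opp (euler_mean b c phi t)).
  2:{ apply functional_extensionality. intros t. now rewrite euler_mean_opp. }
  rewrite !euler_mean_opp //; try lra; try (intros; now apply continuous_euler_mean).
  now rewrite scal_opp_r E1.
Qed.

Lemma continuous_bernstein (n : nat) (c : nat -> V) (u : R) : continuous (bernstein n c) u.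
Proof.
  revert c. induction n as [|n IH]; intros c; simpl.
  - apply continuous_const.
  - apply (continuous_plus (V := V)); apply (continuous_scal (V := V)); auto.
    + apply (continuous_minus (V := R_NormedModule)); [apply continuous_const|apply continuous_id].
    + apply continuous_id.
Qed.

Lemma continuous_pow (k : nat) (u : R) : continuous (fun u => u ^ k) u.
Proof. apply (ex_derive_continuous (V := R_NormedModule)). auto_derive. auto. Qed.

(** The prefactor u^k strengthens the induction: the coefficients 1 - u and u of the recursion only
    produce further prefactors u^k and u^(k+1). *)
Lemma mean_compose_bernstein (a b c : R) (n k : nat) (p : nat -> V) :
  0 < a -> 0 < b -> 0 < c ->
  mean_compose_at_1 a b c (fun u => scal (u ^ k) (bernstein n p u)).
Proof.
  intros Ha Hb Hc. revert k p. induction n as [|n IH]; intros k p.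
  - exact (mean_compose_monomial a b c k (p O) Ha Hb Hc).
  - replace (fun u => scal (u ^ k) (bernstein (S n) p u)) with
      (fun u => plus (plus (scal (u ^ k) (bernstein n p u))
                           (opp (scal (u ^ S k) (bernstein n p u))))
                     (scal (u ^ S k) (bernstein n (fun j => p (S j)) u))).
    + assert (Hcont : forall (k : nat) (p : nat -> V) r,
        continuous (fun u => scal (u ^ k) (bernstein n p u)) r).
      { intros k' p' r. apply (continuous_scal (V := V)); [apply continuous_pow|apply continuous_bernstein]. }
      apply mean_compose_plus; auto.
      * intros r. apply (continuous_plus (V := V)); [apply Hcont|].
        apply (continuous_opp (V := V)). apply Hcont.
      * apply mean_compose_plus; auto.
        -- intros r. apply (continuous_opp (V := V)). apply Hcont.
        -- apply mean_compose_opp; auto.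
    + apply functional_extensionality. intros u. simpl bernstein.
      rewrite scal_distr_l !scal_assoc. f_equal.
      * rewrite -scal_opp_l -scal_distr_r. f_equal. unfold plus, opp, mult; simpl. ring.
      * f_equal. unfold mult; simpl. ring.
Qed.

Lemma mean_compose_continuous (a b c : R) (phi : R -> V) : 0 < a -> 0 < b -> 0 < c ->
  (forall r, continuous phi r) -> mean_compose_at_1 a b c phi.
Proof.
  intros Ha Hb Hc H.
  assert (B1 := Beta_pos b c Hb Hc). assert (B2 := Beta_pos a (b + c) Ha ltac:(lra)).
  assert (B3 := Beta_pos (a + b) c ltac:(lra) Hc).
  set (N := Beta b c * Beta a (b + c)). assert (HN : 0 < N) by now apply Rmult_lt_0_compat.
  set (D := fun psi => minus (euler_mean a (b + c) (euler_mean b c psi) 1)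
    (scal (compose_factor a b c) (euler_mean (a + b) c psi 1))).
  (* Both operators in [D] have the same bound N for the supremum norm on [0,1], so an approximation
     of phi within e/(2N) costs e/2 in each. *)
  assert (Hk : compose_factor a b c * Beta (a + b) c = N).
  { unfold compose_factor, N. field. lra. }
  assert (Hk0 : 0 < compose_factor a b c).
  { unfold compose_factor. apply Rdiv_lt_0_compat; auto. }
  assert (HD : norm (D phi) <= 0).
  { apply Rle_plus_epsilon. intros e He. rewrite Rplus_0_l.
    destruct (bernstein_approx phi (e / (2 * N)) H) as [n [p Hp]].
    { apply Rdiv_lt_0_compat; lra. }
    set (psi := bernstein n p).
    assert (Hpsi : forall r, continuous psi r) by (intros; apply continuous_bernstein).
    assert (Epsi : mean_compose_at_1 a b c psi).
    { assert (E := mean_compose_bernstein a b c n 0 p Ha Hb Hc).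
      replace psi with (fun u => scal (u ^ 0) (bernstein n p u)); auto.
      apply functional_extensionality. intros u. exact (scal_one _). }
    set (chi := fun r => minus (psi r) (phi r)).
    assert (Hchi : forall r, continuous chi r) by (intros; now apply (continuous_minus (V := V))).
    (* [D] is additive and vanishes on the Bernstein polynomial [psi]. *)
    assert (E : D phi = opp (D chi)).
    { unfold D, chi.
      replace (euler_mean b c (fun r => minus (psi r) (phi r)))
        with (fun t => minus (euler_mean b c psi t) (euler_mean b c phi t)).
      2:{ apply functional_extensionality. intros t. now rewrite euler_mean_minus. }
      rewrite !euler_mean_minus //; try lra; try (intros; now apply continuous_euler_mean).
      rewrite Epsi scal_minus_distr_l minus_minus_cancel. now rewrite opp_minus. }
    rewrite E norm_opp. unfold D.
    assert (Hchi1 : forall u, 0 <= u <= 1 -> norm (chi u) <= e / (2 * N)) by (intros; now apply Hp).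
    eapply Rle_trans; [refine (norm_triangle (V := V) _ _)|]. rewrite norm_opp norm_scal_R.
    rewrite Rabs_pos_eq; [|lra].
    assert (F1 : norm (euler_mean a (b + c) (euler_mean b c chi) 1)
      <= (e / (2 * N) * Beta b c) * Beta a (b + c)).
    { apply norm_euler_mean_le; auto; [lra|intros; now apply continuous_euler_mean|].
      intros u Hu. rewrite Rmult_1_l. apply norm_euler_mean_le; auto.
      intros v Hv. apply Hchi1. nra. }
    assert (F2 : norm (euler_mean (a + b) c chi 1) <= e / (2 * N) * Beta (a + b) c).
    { apply norm_euler_mean_le; auto; [lra|].
      intros v Hv. apply Hchi1. lra. }
    assert (F3 : compose_factor a b c * norm (euler_mean (a + b) c chi 1) <= e / 2).
    { apply Rle_trans with (compose_factor a b c * (e / (2 * N) * Beta (a + b) c)).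
      - apply Rmult_le_compat_l; lra.
      - right. replace (compose_factor a b c * (e / (2 * N) * Beta (a + b) c))
          with (e / (2 * N) * (compose_factor a b c * Beta (a + b) c)) by ring.
        rewrite Hk. field. lra. }
    replace (e / (2 * N) * Beta b c * Beta a (b + c)) with (e / 2) in F1; [lra|].
    unfold N. field. lra. }
  assert (E : D phi = zero).
  { apply (norm_eq_zero (V := V)). apply Rle_antisym; [exact HD|]. apply (norm_ge_0 (V := V)). }
  exact (minus_zero_eq _ _ E).
Qed.

Lemma euler_mean_dilation (a b : R) (phi : R -> V) (s t : R) :
  euler_mean a b (fun r => phi (s * r)) t = euler_mean a b phi (s * t).
Proof.
  unfold euler_mean. f_equal. apply functional_extensionality. intros u. now rewrite Rmult_assoc.
Qed.

Lemma euler_mean_compose (a b c : R) (phi : R -> V) (t : R) : 0 < a -> 0 < b -> 0 < c ->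
  (forall r, continuous phi r) ->
  euler_mean a (b + c) (euler_mean b c phi) t =
  scal (compose_factor a b c) (euler_mean (a + b) c phi t).
Proof.
  intros Ha Hb Hc H.
  assert (E : mean_compose_at_1 a b c (fun r => phi (t * r))).
  { apply mean_compose_continuous; auto. intros; now apply continuous_dilation. }
  unfold mean_compose_at_1 in E. rewrite euler_mean_dilation Rmult_1_r in E.
  rewrite -E.
  replace (euler_mean b c (fun r => phi (t * r))) with (fun r => euler_mean b c phi (t * r)).
  - now rewrite euler_mean_dilation Rmult_1_r.
  - apply functional_extensionality. intros r. now rewrite euler_mean_dilation.
Qed.

End EulerMean.

(** * Beta in terms of Gamma *)

Lemma filterlim_within_map (f : R -> R) (a b : R) (Q Q' : R -> Prop) :
  continuous f a -> f a = b -> (forall x, Q x -> Q' (f x)) ->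
  filterlim f (within Q (locally a)) (within Q' (locally b)).
Proof.
  intros Hf <- H P HP.
  assert (HP' : locally a (fun x => Q' (f x) -> P (f x))) by exact (Hf _ HP).
  unfold filtermap, within. revert HP'. apply filter_imp. auto.
Qed.

Lemma continuous_affine (p q x : R) : continuous (fun x => p * x + q) x.
Proof. apply (ex_derive_continuous (V := R_NormedModule)). auto_derive. auto. Qed.

Lemma is_RInt_gen_01_le (f g : R -> R) (lf lg : R) :
  (forall u, 0 < u < 1 -> continuous f u) -> (forall u, 0 < u < 1 -> continuous g u) ->
  (forall u, 0 < u < 1 -> f u <= g u) ->
  is_RInt_gen f (at_right 0) (at_left 1) lf -> is_RInt_gen g (at_right 0) (at_left 1) lg ->
  lf <= lg.
Proof.
  intros Hf Hg H Hlf Hlg.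
  assert (Hd := is_RInt_gen_minus (V := R_NormedModule) _ _ _ _ Hlg Hlf).
  assert (Hp : RInt (fun y => minus (g y) (f y)) (/ 2) (/ 2) <= minus lg lf).
  { apply (is_RInt_gen_ge_RInt (fun y => minus (g y) (f y)) (fun u => 0 < u < 1) (at_right 0)
      (at_left 1)); try lra; auto.
    - apply convex_open.
    - intros u Hu. apply (continuous_minus (V := R_NormedModule)); auto.
    - intros u Hu. unfold minus, plus, opp; simpl. specialize (H u Hu). lra.
    - generalize (at_right_interval 0 (/ 2) ltac:(lra)). apply filter_imp. intros; lra.
    - generalize (at_left_interval (/ 2) 1 ltac:(lra)). apply filter_imp. intros; lra. }
  rewrite RInt_point in Hp. unfold minus, plus, opp, zero in Hp; simpl in Hp. lra.
Qed.

Lemma euler_kernel_1 (a u : R) : 0 < u -> euler_kernel a 1 u = Rpower (1 - u) (a - 1).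
Proof. intros Hu. unfold euler_kernel. rewrite Rminus_diag Rpower_O //. ring. Qed.

Lemma Beta_1 (a : R) : 0 < a -> Beta a 1 = / a.
Proof.
  intros Ha.
  replace (/ a) with (minus (0 / 1) (- (1 / a))).
  2:{ unfold minus, plus, opp; simpl. field. lra. }
  refine (is_RInt_gen_unique (V := R_CompleteNormedModule) (euler_kernel a 1) _ _).
  apply (is_RInt_gen_derive (V := R_CompleteNormedModule) (fun u => 0 < u < 1)
    (euler_majorant_primitive 1 0 a 1) _ (at_right 0) (at_left 1)).
  - apply convex_open.
  - intros u Hu. replace (euler_kernel a 1 u) with (euler_majorant 1 0 a 1 u).
    + apply is_derive_euler_majorant; lra.
    + rewrite euler_kernel_1; [|lra]. unfold euler_majorant. ring.
  - intros u Hu. now apply continuous_euler_kernel.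
  - apply at_right_interval; lra.
  - apply at_left_interval; lra.
  - apply filterlim_euler_majorant_0. lra.
  - apply filterlim_euler_majorant_1. lra.
Qed.

Definition exp_mean (a t : R) : R := euler_mean (V := R_CompleteNormedModule) a 1 exp t.

(* Substitute s = t (1 - u) in the incomplete Gamma integral. *)
Lemma lower_gamma_exp_mean (a t : R) : 0 < a -> 0 < t ->
  lower_gamma a t = Rpower t a * exp (- t) * exp_mean a t.
Proof.
  intros Ha Ht.
  assert (H1 : is_RInt_gen (fun u => scal (- t) (gamma_integrand a (- t * u + t)))
    (at_right 0) (at_left 1) (opp (lower_gamma a t))).
  { apply (is_RInt_gen_comp_lin (V := R_NormedModule) (gamma_integrand a) (- t) t
      (at_right 0) (at_left 1) (at_left t) (at_right 0)).
    - apply filterlim_within_map; [apply continuous_affine|ring|intros; nra].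
    - apply filterlim_within_map; [apply continuous_affine|ring|intros; nra].
    - apply (is_RInt_gen_swap (V := R_NormedModule) (Fa := at_left t) (Fb := at_right 0)).
      now apply lower_gamma_correct. }
  assert (H2 := is_RInt_gen_euler_mean (V := R_CompleteNormedModule) a 1 exp t Ha Rlt_0_1
    continuous_exp).
  apply (is_RInt_gen_scal (V := R_NormedModule) _ (- (Rpower t a * exp (- t)))) in H2.
  assert (H3 : is_RInt_gen (fun u => scal (- t) (gamma_integrand a (- t * u + t)))
    (at_right 0) (at_left 1) (scal (- (Rpower t a * exp (- t))) (exp_mean a t))).
  { revert H2. apply (is_RInt_gen_ext (V := R_NormedModule) (Fa := at_right 0) (Fb := at_left 1)).
    apply Filter_prod with (1 := at_right_interval 0 (/ 2) ltac:(lra))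
      (2 := at_left_interval (/ 2) 1 ltac:(lra)). simpl. intros v w Hv Hw u Hu.
    rewrite Rmin_left in Hu; [|lra]. rewrite Rmax_right in Hu; [|lra].
    unfold scal; simpl. unfold mult; simpl. rewrite euler_kernel_1; [|lra].
    unfold gamma_integrand. replace (- t * u + t) with (t * (1 - u)) by ring.
    rewrite -(Rpower_mult_distr t (1 - u) (a - 1)); try lra.
    rewrite -(Rpower_minus_1 t a Ht).
    replace (- (t * (1 - u))) with (- t + t * u) by ring. rewrite exp_plus. ring. }
  apply (is_RInt_gen_unique (V := R_CompleteNormedModule)) in H1.
  apply (is_RInt_gen_unique (V := R_CompleteNormedModule)) in H3.
  rewrite H1 in H3. unfold opp, scal in H3; simpl in H3. unfold mult in H3; simpl in H3. lra.
Qed.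

(** One spare power: t^(a+1) exp(-t) <= k gives t^a exp(-t) <= k/t. *)
Lemma Rpower_exp_lim_0 (a : R) : 0 < a ->
  filterlim (fun t => Rpower t a * exp (- t)) (Rbar_locally p_infty) (locally 0).
Proof.
  intros Ha. set (k := exp ((a + 1) * ln (a + 1) - (a + 1))).
  assert (Hk : 0 < k) by apply exp_pos.
  apply (proj2 (filterlim_norm_iff (V := R_NormedModule) _ _ _)). intros e He.
  exists (k / e). intros t Ht.
  assert (Hke : 0 < k / e) by now apply Rdiv_lt_0_compat.
  unfold minus, plus, opp, norm; simpl. unfold abs; simpl.
  assert (Hpos : 0 < Rpower t a * exp (- t))
    by (apply Rmult_lt_0_compat; [apply Rpower_pos|apply exp_pos]).
  rewrite Ropp_0 Rplus_0_r Rabs_pos_eq; [|lra].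
  assert (H := Rpower_exp_bound (a + 1) t ltac:(lra) ltac:(lra)). fold k in H.
  rewrite Rpower_plus Rpower_1 in H; [|lra].
  assert (H1 : Rpower t a * exp (- t) * t <= k).
  { apply Rmult_le_reg_r with (exp t); [apply exp_pos|].
    replace (Rpower t a * exp (- t) * t * exp t) with (Rpower t a * t * (exp (- t) * exp t)) by ring.
    rewrite -exp_plus Rplus_opp_l exp_0. lra. }
  apply Rmult_lt_compat_r with (r := e) in Ht; [|lra].
  replace (k / e * e) with k in Ht by (field; lra). nra.
Qed.

Lemma compose_factor_1 (a b : R) : 0 < a -> 0 < b -> compose_factor a b 1 = Beta a b.
Proof.
  intros Ha Hb. unfold compose_factor. rewrite !Beta_1; try lra.
  assert (H := Beta_succ a b Ha Hb).
  replace (Beta a (b + 1)) with (b * Beta a b / (a + b)) by (rewrite -H; field; lra).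
  field. lra.
Qed.

(** The composition law tested on the exponential: J^a J^b exp is a constant times J^(a+b) exp,
    multiplied by exp(-t) and expressed through incomplete Gamma functions. With c = 1 the weight is
    trivial and the constant is [Beta a b]. *)
Lemma Beta_lower_gamma (a b t : R) : 0 < a -> 0 < b -> 0 < t ->
  is_RInt_gen (fun u => Rpower t a * exp (- t) *
      (euler_kernel a 1 u * (exp (t * u) * lower_gamma b (t * u))))
    (at_right 0) (at_left 1) (Beta a b * lower_gamma (a + b) t).
Proof.
  intros Ha Hb Ht.
  assert (H := is_RInt_gen_euler_mean (V := R_CompleteNormedModule) a (b + 1)
    (exp_mean b) t Ha ltac:(lra)
    (fun r => continuous_euler_mean (V := R_CompleteNormedModule) b 1 exp r Hb Rlt_0_1 continuous_exp)).
  assert (E : euler_mean (V := R_CompleteNormedModule) a (b + 1) (exp_mean b) t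
              = Beta a b * exp_mean (a + b) t).
  { rewrite -compose_factor_1 //.
    exact (euler_mean_compose (V := R_CompleteNormedModule) a b 1 exp t Ha Hb Rlt_0_1 continuous_exp). }
  rewrite E in H.
  apply (is_RInt_gen_scal (V := R_NormedModule) _ (Rpower t (a + b) * exp (- t))) in H.
  replace (Beta a b * lower_gamma (a + b) t)
    with (scal (Rpower t (a + b) * exp (- t)) (Beta a b * exp_mean (a + b) t)).
  2:{ rewrite (lower_gamma_exp_mean (a + b)); try lra. unfold scal; simpl. unfold mult; simpl. ring. }
  revert H. apply (is_RInt_gen_ext (V := R_NormedModule) (Fa := at_right 0) (Fb := at_left 1)).
  apply Filter_prod with (1 := at_right_interval 0 (/ 2) ltac:(lra))
    (2 := at_left_interval (/ 2) 1 ltac:(lra)). simpl. intros v w Hv Hw u Hu.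
  rewrite Rmin_left in Hu; [|lra]. rewrite Rmax_right in Hu; [|lra].
  assert (Htu : 0 < t * u) by (apply Rmult_lt_0_compat; lra).
  rewrite (lower_gamma_exp_mean b (t * u) Hb Htu).
  unfold scal; simpl. unfold mult; simpl. rewrite euler_kernel_1; [|lra].
  unfold euler_kernel. replace (b + 1 - 1) with b by ring.
  rewrite -(Rpower_mult_distr t u b) ?Rpower_plus; try lra.
  replace (exp (t * u) * (Rpower t b * Rpower u b * exp (- (t * u)) * exp_mean b (t * u)))
    with (Rpower t b * Rpower u b * exp_mean b (t * u) * (exp (t * u) * exp (- (t * u)))) by ring.
  rewrite -exp_plus Rplus_opp_r exp_0. ring.
Qed.

Lemma continuous_Beta_lower_gamma (a b t u : R) : 0 < a -> 0 < b -> 0 < t -> 0 < u < 1 ->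
  continuous (fun u => Rpower t a * exp (- t) *
      (euler_kernel a 1 u * (exp (t * u) * lower_gamma b (t * u)))) u.
Proof.
  intros Ha Hb Ht Hu.
  apply (continuous_scal_r (V := R_NormedModule)).
  apply (continuous_mult (K := R_AbsRing)); [now apply continuous_euler_kernel|].
  apply (continuous_mult (K := R_AbsRing)).
  - apply (continuous_comp (fun u => t * u) exp); [|apply continuous_exp].
    apply (continuous_scal_r (V := R_NormedModule)). apply continuous_id.
  - apply (continuous_comp (fun u => t * u) (lower_gamma b)).
    + apply (continuous_scal_r (V := R_NormedModule)). apply continuous_id.
    + assert (Htu : 0 < t * u) by (apply Rmult_lt_0_compat; lra).
      apply continuous_ext_loc with (fun t => Rpower t b * exp (- t) * exp_mean b t).
      * exists (mkposreal _ Htu). intros y Hy. symmetry. apply lower_gamma_exp_mean; auto.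
        apply Rabs_def2 in Hy. unfold minus, plus, opp in Hy; simpl in Hy. lra.
      * apply (continuous_mult (K := R_AbsRing)).
        -- apply (continuous_mult (K := R_AbsRing)); [now apply continuous_Rpower|apply continuous_exp_opp].
        -- exact (continuous_euler_mean (V := R_CompleteNormedModule) b 1 exp (t * u) Hb Rlt_0_1
             continuous_exp).
Qed.

Lemma continuous_exp_shift (c r : R) : continuous (fun r => exp r - c) r.
Proof.
  apply (continuous_minus (V := R_NormedModule)); [apply continuous_exp|apply continuous_const].
Qed.

(** The comparison integrals for [Beta_Gamma]: c = 0 serves the upper bound and c = exp r the lower
    one. *)
Lemma is_RInt_gen_exp_shift (a c t k : R) : 0 < a -> 0 < t ->
  is_RInt_gen (fun u => k * (Rpower t a * exp (- t) * (euler_kernel a 1 u * (exp (t * u) - c))))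
    (at_right 0) (at_left 1)
    (k * (lower_gamma a t - c / a * (Rpower t a * exp (- t)))).
Proof.
  intros Ha Ht.
  assert (H := is_RInt_gen_euler_mean (V := R_CompleteNormedModule) a 1
    (fun r => exp r - c) t Ha Rlt_0_1 (continuous_exp_shift c)).
  apply (is_RInt_gen_scal (V := R_NormedModule) _ (Rpower t a * exp (- t))) in H.
  apply (is_RInt_gen_scal (V := R_NormedModule) _ k) in H.
  assert (E : euler_mean (V := R_CompleteNormedModule) a 1 (fun r => exp r - c) t
    = exp_mean a t - c / a).
  { assert (E := euler_mean_minus (V := R_CompleteNormedModule) a 1 exp (fun _ => c) t Ha Rlt_0_1
      continuous_exp (fun r => continuous_const c r)).
    rewrite euler_mean_const // in E; [|lra]. rewrite Beta_1 // in E.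
    etransitivity; [exact E|].
    unfold exp_mean, minus, plus, opp, scal, Rdiv; simpl. unfold mult; simpl. ring. }
  rewrite E in H.
  replace (k * (lower_gamma a t - c / a * (Rpower t a * exp (- t)))) with
    (scal k (scal (Rpower t a * exp (- t)) (exp_mean a t - c / a))); [exact H|].
  rewrite lower_gamma_exp_mean //. unfold scal; simpl. unfold mult; simpl. ring.
Qed.

Lemma continuous_exp_shift_integrand (a c t k u : R) : 0 < u < 1 ->
  continuous (fun u => k * (Rpower t a * exp (- t) * (euler_kernel a 1 u * (exp (t * u) - c)))) u.
Proof.
  intros Hu. do 2 apply (continuous_scal_r (V := R_NormedModule)).
  apply (continuous_mult (K := R_AbsRing)); [now apply continuous_euler_kernel|].
  apply (continuous_comp (fun u => t * u) (fun r => exp r - c)); [|apply continuous_exp_shift].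
  apply (continuous_scal_r (V := R_NormedModule)). apply continuous_id.
Qed.

(** In [Beta_lower_gamma] the inner factor [lower_gamma b (t * u)] tends to Gamma(b) as t grows, for
    each u. Two pointwise comparisons of integrands replace an exchange of limit and integral:
    bounding the factor by Gamma(b) gives one inequality as t -> oo, and bounding it below by its
    value at a fixed r gives the other as t -> oo and then r -> oo. *)
Lemma Beta_Gamma (a b : R) : 0 < a -> 0 < b -> Beta a b * Gamma (a + b) = Gamma a * Gamma b.
Proof.
  intros Ha Hb.
  assert (Hab : 0 < a + b) by lra.
  assert (Hw : forall t u, 0 < t -> 0 < u -> 0 < Rpower t a * exp (- t) * euler_kernel a 1 u).
  { intros t u Ht Hu. apply Rmult_lt_0_compat; [|apply euler_kernel_pos].
    apply Rmult_lt_0_compat; [apply Rpower_pos|apply exp_pos]. }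
  assert (Hl : filterlim (fun t => Beta a b * lower_gamma (a + b) t) (Rbar_locally p_infty)
    (locally (Beta a b * Gamma (a + b)))).
  { refine (filterlim_scal_R _ _ _ _ _). now apply lower_gamma_lim. }
  assert (Hlc : forall c k, filterlim (fun t => k * (lower_gamma a t + (- (c / a)) * (Rpower t a * exp (- t))))
    (Rbar_locally p_infty) (locally (k * (Gamma a + - (c / a) * 0)))).
  { intros c k. refine (filterlim_scal_R _ _ _ _ _). refine (filterlim_plus_R _ _ _ _ _ _ _).
    - now apply lower_gamma_lim.
    - refine (filterlim_scal_R _ _ _ _ _). now apply Rpower_exp_lim_0. }
  apply Rle_antisym.
  - replace (Gamma a * Gamma b) with (Gamma b * (Gamma a + - (0 / a) * 0)) by ring.
    apply (filterlim_le (F := Rbar_locally p_infty) _ _ (Beta a b * Gamma (a + b))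
      (Gamma b * (Gamma a + - (0 / a) * 0)) ) with (2 := Hl) (3 := Hlc 0 (Gamma b)).
    exists 0. intros t Ht.
    replace (Gamma b * (lower_gamma a t + - (0 / a) * (Rpower t a * exp (- t))))
      with (Gamma b * (lower_gamma a t - 0 / a * (Rpower t a * exp (- t)))) by ring.
    apply (is_RInt_gen_01_le _ _ _ _
      (fun u Hu => continuous_Beta_lower_gamma a b t u Ha Hb Ht Hu)
      (fun u Hu => continuous_exp_shift_integrand a 0 t (Gamma b) u Hu))
      with (2 := Beta_lower_gamma a b t Ha Hb Ht) (3 := is_RInt_gen_exp_shift a 0 t (Gamma b) Ha Ht).
    intros u Hu. rewrite Rminus_0_r.
    assert (H1 := Hw t u Ht ltac:(lra)).
    assert (H2 := lower_gamma_le b (t * u) Hb ltac:(nra)).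
    assert (H3 := exp_pos (t * u)).
    replace (Gamma b * (Rpower t a * exp (- t) * (euler_kernel a 1 u * exp (t * u))))
      with (Rpower t a * exp (- t) * euler_kernel a 1 u * (exp (t * u) * Gamma b)) by ring.
    rewrite -Rmult_assoc. apply Rmult_le_compat_l; [lra|]. apply Rmult_le_compat_l; lra.
  (* The minorant (exp s - exp r) [lower_gamma b r] of exp s [lower_gamma b s] holds for every s = t
     u: by monotonicity if s >= r, by sign if s < r. The subtracted exp r contributes a multiple of
     t^a exp(-t), which disappears in the limit. *)
  - assert (HR : forall r, 0 < r -> lower_gamma b r * Gamma a <= Beta a b * Gamma (a + b)).
    { intros r Hr.
      replace (lower_gamma b r * Gamma a)
        with (lower_gamma b r * (Gamma a + - (exp r / a) * 0)) by ring.
      apply (filterlim_le (F := Rbar_locally p_infty) _ _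
        (lower_gamma b r * (Gamma a + - (exp r / a) * 0)) (Beta a b * Gamma (a + b)))
        with (2 := Hlc (exp r) (lower_gamma b r)) (3 := Hl).
      exists 0. intros t Ht.
      replace (lower_gamma b r * (lower_gamma a t + - (exp r / a) * (Rpower t a * exp (- t))))
        with (lower_gamma b r * (lower_gamma a t - exp r / a * (Rpower t a * exp (- t)))) by ring.
      apply (is_RInt_gen_01_le _ _ _ _
        (fun u Hu => continuous_exp_shift_integrand a (exp r) t (lower_gamma b r) u Hu)
        (fun u Hu => continuous_Beta_lower_gamma a b t u Ha Hb Ht Hu))
        with (2 := is_RInt_gen_exp_shift a (exp r) t (lower_gamma b r) Ha Ht)
             (3 := Beta_lower_gamma a b t Ha Hb Ht).
      intros u Hu.
      assert (H1 := Hw t u Ht ltac:(lra)).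
      assert (Htu : 0 < t * u) by nra.
      assert (H3 := exp_pos (t * u)).
      replace (lower_gamma b r * (Rpower t a * exp (- t) * (euler_kernel a 1 u * (exp (t * u) - exp r))))
        with (Rpower t a * exp (- t) * euler_kernel a 1 u * ((exp (t * u) - exp r) * lower_gamma b r)) by ring.
      replace (Rpower t a * exp (- t) * (euler_kernel a 1 u * (exp (t * u) * lower_gamma b (t * u))))
        with (Rpower t a * exp (- t) * euler_kernel a 1 u * (exp (t * u) * lower_gamma b (t * u))) by ring.
      apply Rmult_le_compat_l; [lra|].
      assert (H4 := lower_gamma_ge_0 b r Hb Hr). assert (H5 := lower_gamma_ge_0 b _ Hb Htu). assert (H6 := exp_pos r).
      destruct (Rle_lt_dec r (t * u)) as [Hle|Hlt].
      - assert (H7 := lower_gamma_incr b r (t * u) Hb (conj Hr Hle)). nra.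
      - assert (H7 := exp_increasing _ _ Hlt). nra. }
    apply (filterlim_le (F := Rbar_locally p_infty) (fun r => Gamma a * lower_gamma b r)
      (fun _ => Beta a b * Gamma (a + b)) (Gamma a * Gamma b) (Beta a b * Gamma (a + b))).
    + exists 0. intros r Hr. rewrite Rmult_comm. now apply HR.
    + refine (filterlim_scal_R _ _ _ _ _). now apply lower_gamma_lim.
    + apply filterlim_const.
Qed.

Lemma compose_factor_Gamma (a b c : R) : 0 < a -> 0 < b -> 0 < c ->
  compose_factor a b c * Gamma (a + b) = Gamma a * Gamma b.
Proof.
  intros Ha Hb Hc. unfold compose_factor.
  assert (H1 := Beta_Gamma b c Hb Hc). assert (H2 := Beta_Gamma a (b + c) Ha ltac:(lra)).
  assert (H3 := Beta_Gamma (a + b) c ltac:(lra) Hc).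
  assert (G1 := Gamma_pos (b + c) ltac:(lra)). assert (G2 := Gamma_pos (a + (b + c)) ltac:(lra)).
  assert (G3 := Gamma_pos (a + b) ltac:(lra)). assert (G4 := Gamma_pos c Hc).
  rewrite Rplus_assoc in H3.
  assert (E1 : Beta b c = Gamma b * Gamma c / Gamma (b + c)) by (rewrite -H1; field; lra).
  assert (E2 : Beta a (b + c) = Gamma a * Gamma (b + c) / Gamma (a + (b + c)))
    by (rewrite -H2; field; lra).
  assert (E3 : Beta (a + b) c = Gamma (a + b) * Gamma c / Gamma (a + (b + c)))
    by (rewrite -H3; field; lra).
  rewrite E1 E2 E3. field. lra.
Qed.

(** * Fractional integrals of functions with a power singularity at 0 *)

Lemma filterlim_rescale_0 (t : R) : 0 < t ->
  filterlim (fun s => / t * s + 0) (at_right 0) (at_right 0).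
Proof.
  intros Ht. apply filterlim_within_map; [apply continuous_affine|ring|].
  intros x Hx. assert (0 < / t) by now apply Rinv_0_lt_compat. nra.
Qed.

Lemma filterlim_rescale_1 (t : R) : 0 < t ->
  filterlim (fun s => / t * s + 0) (at_left t) (at_left 1).
Proof.
  intros Ht. apply filterlim_within_map; [apply continuous_affine|field; lra|].
  intros x Hx. apply Rmult_lt_reg_l with t; auto.
  replace (t * (/ t * x + 0)) with x by (field; lra). lra.
Qed.

Section Weighted.

Context {X : CompleteNormedModule R_AbsRing}.

(** The profile [phi] is an explicit argument because J acts on it by a mean. Its continuity across
    0 gives the bounds on [0,T], and phi(0) is the leading coefficient of f at 0. *)
Definition power_weighted (b : R) (phi f : R -> X) : Prop :=
  (forall r, continuous phi r) /\ (forall r, 0 < r -> f r = scal (Rpower r (b - 1)) (phi r)).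

Lemma power_weighted_continuous (b : R) (phi f : R -> X) (r : R) :
  power_weighted b phi f -> 0 < r -> continuous f r.
Proof.
  intros [H1 H2] Hr.
  apply continuous_ext_loc with (fun r => scal (Rpower r (b - 1)) (phi r)).
  - exists (mkposreal _ Hr). intros y Hy. symmetry. apply H2.
    apply Rabs_def2 in Hy. unfold minus, plus, opp in Hy; simpl in Hy. lra.
  - apply (continuous_scal (V := X)); auto. now apply continuous_Rpower.
Qed.

Lemma power_weighted_bounded (b : R) (phi f : R -> X) (T : R) :
  power_weighted b phi f ->
  exists S, forall r, 0 < r <= T -> norm (f r) <= S * Rpower r (b - 1).
Proof.
  intros [H1 H2]. destruct (bounded_continuity phi 0 T (fun x _ => H1 x)) as [S HS].
  exists S. intros r Hr. rewrite H2; [|lra]. rewrite norm_scal_R Rabs_pos_eq.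
  - rewrite Rmult_comm. apply Rmult_le_compat_r; [left; apply Rpower_pos|]. left. apply HS. lra.
  - left; apply Rpower_pos.
Qed.

Lemma power_weighted_lim0 (b : R) (phi f : R -> X) :
  1 < b -> power_weighted b phi f -> lim0 f zero.
Proof.
  intros Hb Hf. destruct (power_weighted_bounded b phi f 1 Hf) as [S HS].
  unfold lim0.
  refine (filterlim_norm_le_0 (V := X) (at_right 0) f zero (fun r => S * Rpower r (b - 1)) _ _).
  - generalize (at_right_interval 0 1 Rlt_0_1). apply filter_imp. intros r Hr.
    unfold minus. rewrite opp_zero plus_zero_r. apply HS. lra.
  - replace 0 with (S * 0) at 2 by ring. refine (filterlim_scal_R _ _ _ _ _).
    apply filterlim_Rpower_0. lra.
Qed.

(** Substitution u = s/t; the exponent a + b - 1 collects t^(a-1), t^(b-1) and the factor t of ds =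
    t du. *)
Lemma is_RInt_gen_J (a b : R) (phi f : R -> X) (t : R) : 0 < a -> 0 < b -> 0 < t ->
  power_weighted b phi f ->
  is_RInt_gen (J_integrand a f t) (at_right 0) (at_left t)
    (scal (Rpower t (a + b - 1)) (euler_mean a b phi t)).
Proof.
  intros Ha Hb Ht [H1 H2].
  assert (H := is_RInt_gen_comp_lin (V := X) _ (/ t) 0 (at_right 0) (at_left t) _ _ _
    (filterlim_rescale_0 t Ht) (filterlim_rescale_1 t Ht)
    (is_RInt_gen_euler_mean a b phi t Ha Hb H1)).
  apply (is_RInt_gen_scal (V := X) _ (Rpower t (a + b - 1))) in H.
  revert H. apply (is_RInt_gen_ext (V := X) (Fa := at_right 0) (Fb := at_left t)).
  apply Filter_prod with (1 := at_right_interval 0 (t / 2) ltac:(lra))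
    (2 := at_left_interval (t / 2) t ltac:(lra)). simpl. intros v w Hv Hw s Hs.
  rewrite Rmin_left in Hs; [|lra]. rewrite Rmax_right in Hs; [|lra].
  unfold J_integrand. rewrite H2; [|lra]. rewrite !scal_assoc.
  replace (t * (/ t * s + 0)) with s by (field; lra). f_equal.
  unfold mult; simpl. unfold euler_kernel.
  replace (t - s) with (t * (1 - (/ t * s + 0))) by (field; lra).
  assert (Hti : 0 < / t) by now apply Rinv_0_lt_compat.
  assert (Hs1 : 0 < 1 - (/ t * s + 0)).
  { apply Rmult_lt_reg_l with t; auto.
    replace (t * (1 - (/ t * s + 0))) with (t - s) by (field; lra). lra. }
  rewrite -(Rpower_mult_distr t _ (a - 1)); auto.
  replace (Rpower s (b - 1)) with (Rpower (t * (/ t * s + 0)) (b - 1))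
    by (f_equal; field; lra).
  rewrite -(Rpower_mult_distr t _ (b - 1)); auto; [|nra].
  replace (a + b - 1) with ((a - 1) + (b - 1) + 1) by ring.
  rewrite !Rpower_plus Rpower_1 //. field. lra.
Qed.

End Weighted.

(** * The operator J on functions with a power weight *)

Section FractionalIntegral.

Context {X : CompleteNormedModule R_AbsRing}.

Lemma J_0 (f : R -> X) (t : R) : J 0 f t = f t.
Proof. unfold J. destruct (Req_EM_T 0 0); tauto. Qed.

Lemma J_pos_eq (a : R) (f : R -> X) (t : R) (l : X) : 0 < a -> 0 < t ->
  is_RInt_gen (J_integrand a f t) (at_right 0) (at_left t) l ->
  J a f t = scal (/ Gamma a) l.
Proof.
  intros Ha Ht H. unfold J. destruct (Req_EM_T a 0); [lra|]. f_equal.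
  now apply (is_RInt_gen_unique (V := X)).
Qed.

Lemma J_weighted_eq (a b : R) (phi f : R -> X) (t : R) : 0 < a -> 0 < b -> 0 < t ->
  power_weighted b phi f ->
  J a f t = scal (Rpower t (a + b - 1)) (scal (/ Gamma a) (euler_mean a b phi t)).
Proof.
  intros Ha Hb Ht H. rewrite (J_pos_eq a f t _ Ha Ht (is_RInt_gen_J a b phi f t Ha Hb Ht H)).
  rewrite !scal_assoc. f_equal. apply Rmult_comm.
Qed.

(** Absolute convergence is the convergence statement for the real function norm f, which has the
    same weight and the profile norm phi. *)
Lemma ex_J_weighted (a b : R) (phi f : R -> X) (t : R) : 0 <= a -> 0 < b -> 0 < t ->
  power_weighted b phi f -> ex_J a f t.
Proof.
  intros [Ha|<-] Hb Ht H; [|now left]. right. split.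
  - eexists. now apply (is_RInt_gen_J a b phi f t).
  - destruct H as [H1 H2].
    assert (H' : power_weighted (X := R_CompleteNormedModule) b
      (fun r => norm (phi r)) (fun r => norm (f r))).
    { split.
      - intros r. apply (continuous_comp phi norm); [apply H1|].
        apply (filterlim_norm (V := X)).
      - intros r Hr. rewrite (H2 r Hr) norm_scal_R Rabs_pos_eq //. left; apply Rpower_pos. }
    exists (scal (Rpower t (a + b - 1))
      (euler_mean (V := R_CompleteNormedModule) a b (fun r => norm (phi r)) t)).
    assert (HJ := is_RInt_gen_J (X := R_CompleteNormedModule) a b _ _ t Ha Hb Ht H').
    replace (fun s => norm (J_integrand a f t s))
      with (J_integrand (X := R_CompleteNormedModule) a (fun r => norm (f r)) t); auto.
    apply functional_extensionality. intros s. unfold J_integrand.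
    rewrite norm_scal_R Rabs_pos_eq //. left; apply Rpower_pos.
Qed.

Lemma power_weighted_J (a b : R) (phi f : R -> X) : 0 < a -> 0 < b ->
  power_weighted b phi f ->
  power_weighted (a + b) (fun t => scal (/ Gamma a) (euler_mean a b phi t)) (J a f).
Proof.
  intros Ha Hb H. split.
  - intros r. apply (continuous_scal_r (V := X)). apply continuous_euler_mean; auto. apply H.
  - intros r Hr. now apply J_weighted_eq.
Qed.

(** The integrands may differ outside (0, oo), so they are not equal as functions; both integrals
    are computed from the common profile [phi]. *)
Lemma J_ext (a b : R) (phi f g : R -> X) (t : R) : 0 <= a -> 0 < b -> 0 < t ->
  power_weighted b phi f -> (forall r, 0 < r -> f r = g r) -> J a f t = J a g t.
Proof.
  intros [Ha|<-] Hb Ht H E.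
  - rewrite !(J_weighted_eq a b phi) //. destruct H as [H1 H2]. split; auto.
    intros r Hr. rewrite -E //. now apply H2.
  - rewrite !J_0. now apply E.
Qed.

Lemma J_semigroup (a b c : R) (phi f : R -> X) (t : R) : 0 <= a -> 0 < b -> 0 < c -> 0 < t ->
  power_weighted c phi f -> J a (J b f) t = J (a + b) f t.
Proof.
  intros [Ha|<-] Hb Hc Ht H.
  2: now rewrite J_0 Rplus_0_l.
  rewrite (J_weighted_eq a (b + c) _ (J b f) t Ha ltac:(lra) Ht (power_weighted_J b c phi f Hb Hc H)).
  rewrite (J_weighted_eq (a + b) c phi f t ltac:(lra) Hc Ht H).
  rewrite euler_mean_scal; auto; try lra.
  2: intros r; apply continuous_euler_mean; auto; apply H.
  rewrite (euler_mean_compose a b c phi t Ha Hb Hc (proj1 H)).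
  rewrite Rplus_assoc !scal_assoc. f_equal. unfold mult; simpl.
  assert (E := compose_factor_Gamma a b c Ha Hb Hc).
  assert (G1 := Gamma_pos a Ha). assert (G2 := Gamma_pos b Hb).
  assert (G3 := Gamma_pos (a + b) ltac:(lra)).
  replace (compose_factor a b c) with (Gamma a * Gamma b / Gamma (a + b))
    by (rewrite -E; field; lra).
  field. lra.
Qed.

(** Two weights b and c are allowed because the orbit is a sum of g_beta(t) x and a term J^gamma f
    of weight gamma + beta. *)
Lemma J_plus_ext (a b c : R) (phi psi f g h : R -> X) (t : R) :
  0 <= a -> 0 < b -> 0 < c -> 0 < t ->
  power_weighted b phi f -> power_weighted c psi g ->
  (forall r, 0 < r -> h r = plus (f r) (g r)) ->
  J a h t = plus (J a f t) (J a g t).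
Proof.
  intros [Ha|<-] Hb Hc Ht Hf Hg E.
  2: rewrite !J_0; now apply E.
  assert (If := is_RInt_gen_J a b phi f t Ha Hb Ht Hf).
  assert (Ig := is_RInt_gen_J a c psi g t Ha Hc Ht Hg).
  rewrite (J_pos_eq a f t _ Ha Ht If) (J_pos_eq a g t _ Ha Ht Ig) -scal_distr_l.
  apply J_pos_eq; auto.
  assert (I := is_RInt_gen_plus (V := X) _ _ _ _ If Ig). revert I.
  apply (is_RInt_gen_ext (V := X) (Fa := at_right 0) (Fb := at_left t)).
  apply Filter_prod with (1 := at_right_interval 0 (t / 2) ltac:(lra))
    (2 := at_left_interval (t / 2) t ltac:(lra)). simpl. intros v w Hv Hw s Hs.
  rewrite Rmin_left in Hs; [|lra]. unfold J_integrand. rewrite E; [|lra].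
  now rewrite scal_distr_l.
Qed.

Lemma power_weighted_pow_g (b : R) (x : X) :
  power_weighted b (fun _ => scal (/ Gamma b) x) (fun r => scal (pow_g b r) x).
Proof.
  split.
  - intros r. apply continuous_const.
  - intros r Hr. now rewrite scal_assoc.
Qed.

Lemma J_pow_g (a b : R) (x : X) (t : R) : 0 <= a -> 0 < b -> 0 < t ->
  J a (fun r => scal (pow_g b r) x) t = scal (pow_g (a + b) t) x.
Proof.
  intros [Ha|<-] Hb Ht.
  2: now rewrite J_0 Rplus_0_l.
  rewrite (J_weighted_eq a b _ _ t Ha Hb Ht (power_weighted_pow_g b x)).
  rewrite euler_mean_const // !scal_assoc. f_equal. unfold mult, pow_g; simpl.
  assert (E := Beta_Gamma a b Ha Hb).
  assert (G1 := Gamma_pos a Ha). assert (G2 := Gamma_pos b Hb).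
  assert (G3 := Gamma_pos (a + b) ltac:(lra)).
  replace (Beta a b) with (Gamma a * Gamma b / Gamma (a + b)) by (rewrite -E; field; lra).
  field. lra.
Qed.

Lemma J_linear (T : X -> X) (a b : R) (phi f : R -> X) (t : R) : 0 < a -> 0 < b -> 0 < t ->
  is_linear T -> power_weighted b phi f -> T (J a f t) = J a (fun r => T (f r)) t.
Proof.
  intros Ha Hb Ht HT Hf.
  assert (If := is_RInt_gen_J a b phi f t Ha Hb Ht Hf).
  rewrite (J_pos_eq a f t _ Ha Ht If) (linear_scal T HT).
  symmetry. apply J_pos_eq; auto.
  replace (J_integrand a (fun r => T (f r)) t) with (fun s => T (J_integrand a f t s)).
  - exact (is_RInt_gen_linear T _ (at_right 0) (at_left t) _ HT If).
  - apply functional_extensionality. intros s. apply (linear_scal T HT).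
Qed.

(** J^1 f differs from the proper primitive [RInt f 1] by its limit [l] at 0, which exists because f
    is O(s^(b-1)); then the fundamental theorem of calculus applies. *)
Lemma is_derive_J_1 (b : R) (phi f : R -> X) (t : R) : 0 < b -> 0 < t ->
  power_weighted b phi f -> is_derive (J 1 f) t (f t).
Proof.
  intros Hb Ht Hf.
  assert (Hc : forall s, 0 < s -> continuous f s)
    by (intros; now apply (power_weighted_continuous b phi)).
  (* The bound is used on (0,2); the endpoint 2 only has to exceed the base point 1 of the
     primitive. *)
  destruct (power_weighted_bounded b phi f 2 Hf) as [S HS].
  destruct (dominated_primitive_limit (V := X) (fun s => 0 < s < 2) f
    (fun s => S * Rpower s (b - 1)) (fun s => S / b * Rpower s b) 1) with (F := at_right 0) (lG := 0)
    as [l Hl].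
  - apply convex_open.
  - lra.
  - intros s Hs. apply Hc. lra.
  - intros s Hs. apply (continuous_scal_r (V := R_NormedModule)). apply continuous_Rpower. lra.
  - intros s Hs. replace (S * Rpower s (b - 1)) with (S / b * (b * Rpower s (b - 1))) by (field; lra).
    apply is_derive_scal. apply is_derive_Rpower. lra.
  - intros s Hs. apply HS. lra.
  - typeclasses eauto.
  - apply at_right_interval. lra.
  - replace 0 with (S / b * 0) at 2 by ring. refine (filterlim_scal_R _ _ _ _ _).
    now apply filterlim_Rpower_0.
  - apply is_derive_ext_loc with (fun s => minus (RInt f 1 s) l).
    + exists (mkposreal _ Ht). intros s Hs.
      assert (Hs0 : 0 < s).
      { apply Rabs_def2 in Hs. unfold minus, plus, opp in Hs; simpl in Hs. lra. }
      symmetry. rewrite (J_pos_eq 1 f s (minus (RInt f 1 s) l) Rlt_0_1 Hs0).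
      { rewrite Gamma_1 Rinv_1. exact (scal_one _). }
      assert (I := is_RInt_gen_RInt_primitive (V := X) (fun s => 0 < s) f 1 (at_right 0) (at_left s)
        l (RInt f 1 s)).
      assert (I' : is_RInt_gen f (at_right 0) (at_left s) (minus (RInt f 1 s) l)).
      { apply I; auto.
        - intros x y z; lra.
        - lra.
        - generalize (at_right_interval 0 1 Rlt_0_1). apply filter_imp. tauto.
        - generalize (at_left_interval 0 s Hs0). apply filter_imp. tauto.
        - apply filterlim_at_left_continuous.
          apply (ex_derive_continuous (V := X)). eexists.
          apply is_derive_primitive; auto. lra. }
      revert I'. apply (is_RInt_gen_ext (V := X) (Fa := at_right 0) (Fb := at_left s)).
      apply Filter_prod with (1 := at_right_interval 0 (s / 2) ltac:(lra))
        (2 := at_left_interval (s / 2) s ltac:(lra)). simpl. intros v w Hv Hw r Hr.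
      rewrite Rmin_left in Hr; [|lra]. rewrite Rmax_right in Hr; [|lra].
      unfold J_integrand. rewrite Rminus_diag Rpower_O; [|lra]. symmetry. exact (scal_one _).
    + replace (f t) with (minus (f t) zero).
      * apply (is_derive_minus (V := X)); [|apply (is_derive_const (V := X))].
        apply is_derive_primitive; auto. lra.
      * unfold minus. now rewrite opp_zero plus_zero_r.
Qed.

Lemma norm_J_le (a b S : R) (phi f : R -> X) (t : R) : 0 < a -> 0 < b -> 0 < t ->
  power_weighted b phi f -> (forall r, 0 < r < t -> norm (phi r) <= S) ->
  norm (J a f t) <= Rpower t (a + b - 1) * (/ Gamma a * (S * Beta a b)).
Proof.
  intros Ha Hb Ht Hf HS. rewrite (J_weighted_eq a b phi f t Ha Hb Ht Hf) !norm_scal_R.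
  assert (G := Gamma_pos a Ha). assert (Gi : 0 < / Gamma a) by now apply Rinv_0_lt_compat.
  assert (Hp := Rpower_pos t (a + b - 1)).
  rewrite !Rabs_pos_eq; try lra.
  apply Rmult_le_compat_l; [lra|]. apply Rmult_le_compat_l; [lra|].
  apply norm_euler_mean_le; auto; [apply Hf|]. intros u Hu. apply HS. nra.
Qed.

(** The quotient is a multiple of the mean of phi, which is continuous at t = 0 and there sees only
    the constant phi(0). *)
Lemma J_lim0 (a b : R) (phi f : R -> X) : 0 < a -> 0 < b -> power_weighted b phi f ->
  lim0 (fun t => scal (/ Rpower t (a + b - 1)) (J a f t))
    (scal (Gamma b / Gamma (a + b)) (phi 0)).
Proof.
  intros Ha Hb Hf.
  assert (Hc : continuous (fun t => scal (/ Gamma a) (euler_mean a b phi t)) 0).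
  { apply (continuous_scal_r (V := X)). apply continuous_euler_mean; auto. apply Hf. }
  replace (scal (Gamma b / Gamma (a + b)) (phi 0))
    with (scal (/ Gamma a) (euler_mean a b phi 0)).
  - apply filterlim_ext_loc with (fun t => scal (/ Gamma a) (euler_mean a b phi t)).
    + generalize (at_right_interval 0 1 Rlt_0_1). apply filter_imp. intros t Ht.
      rewrite (J_weighted_eq a b phi f t Ha Hb ltac:(lra) Hf).
      assert (Hp := Rpower_pos t (a + b - 1)).
      rewrite !scal_assoc. f_equal. unfold mult; simpl. field.
      split; [apply Rgt_not_eq; now apply Gamma_pos|lra].
    + exact (filterlim_at_right_continuous _ 0 Hc).
  - replace (euler_mean a b phi 0) with (euler_mean a b (fun _ => phi 0) 0).
    + rewrite euler_mean_const // scal_assoc. f_equal. unfold mult; simpl.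
      assert (E := Beta_Gamma a b Ha Hb).
      assert (G1 := Gamma_pos a Ha). assert (G3 := Gamma_pos (a + b) ltac:(lra)).
      replace (Beta a b) with (Gamma a * Gamma b / Gamma (a + b)) by (rewrite -E; field; lra).
      field. lra.
    + unfold euler_mean. f_equal. apply functional_extensionality. intros u. now rewrite Rmult_0_l.
Qed.

End FractionalIntegral.

(** * Uniform boundedness *)

Section UniformBoundedness.

Context {X Y : CompleteNormedModule R_AbsRing} {I : Type}.
Variable T : I -> X -> Y.
Hypothesis HT : forall i, is_linear (T i).

Lemma linear_minus (L : X -> Y) (x y : X) : is_linear L -> L (minus x y) = minus (L x) (L y).
Proof. intros HL. unfold minus. now rewrite (linear_plus L HL) (linear_opp L y HL). Qed.

(** The vectors T(x + xi) and T(x - xi) differ by 2 T xi, so one of them has norm at least that of T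
    xi. A ball of radius at most 1/M around the better point, M bounding T, loses at most 1. *)
Lemma resonance_ball (Hunb : forall N, 0 <= N -> exists i x, N * norm x < norm (T i x))
    (n : nat) (x : X) (r : posreal) :
  exists (x' : X) (r' : posreal), r' <= r / 2 /\ norm (minus x' x) <= r / 2 /\
    exists i, forall y, norm (minus y x') <= r' -> INR n < norm (T i y).
Proof.
  assert (Hr := cond_pos r). assert (Hn := pos_INR n).
  (* With this constant, [z] rescaled to length r/2 has an image of norm above n + 1. *)
  destruct (Hunb (2 * (INR n + 1) / r)) as [i [z Hz]].
  { left. apply Rdiv_lt_0_compat; lra. }
  assert (Hz0 : 0 < norm z).
  { destruct (norm_ge_0 z) as [|E]; auto. exfalso.
    assert (Ez : z = zero) by now apply (norm_eq_zero (V := X)).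
    rewrite Ez (linear_zero _ (HT i)) !norm_zero in Hz. lra. }
  destruct (linear_norm _ (HT i)) as [M [HM HTM]].
  set (xi := scal (r / (2 * norm z)) z).
  assert (Hk : 0 < r / (2 * norm z)) by (apply Rdiv_lt_0_compat; lra).
  assert (Hxi : norm xi = r / 2).
  { unfold xi. rewrite norm_scal_R Rabs_pos_eq; [field|]; lra. }
  assert (HTxi : INR n + 1 < norm (T i xi)).
  { unfold xi. rewrite (linear_scal _ (HT i)) norm_scal_R Rabs_pos_eq; [|lra].
    apply Rmult_lt_compat_l with (1 := Hk) in Hz.
    replace (r / (2 * norm z) * (2 * (INR n + 1) / r * norm z)) with (INR n + 1) in Hz
      by (field; lra). exact Hz. }
  assert (Hx' : exists x', norm (minus x' x) <= r / 2 /\ INR n + 1 < norm (T i x')).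
  { destruct (Rlt_le_dec (INR n + 1) (norm (T i (plus x xi)))) as [H|H].
    - exists (plus x xi). split; auto. rewrite plus_minus_l. lra.
    - exists (minus x xi). split.
      + change (minus x xi) with (plus x (opp xi)). rewrite plus_minus_l norm_opp. lra.
      + rewrite linear_minus //. rewrite (linear_plus _ (HT i)) in H.
        set (p := plus (T i x) (T i xi)). set (q := minus (T i x) (T i xi)).
        change (norm p <= INR n + 1) in H.
        assert (E : scal 2 (T i xi) = minus p q).
        { unfold p, q, minus. rewrite opp_plus opp_opp plus_interchange plus_opp_r plus_zero_l.
          transitivity (scal (plus (@one R_Ring) one) (T i xi)).
          - apply (f_equal (fun k : R => scal k (T i xi))). unfold plus, one; simpl. ring.
          - rewrite scal_distr_r. f_equal; exact (scal_one _). }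
        assert (H1 : 2 * norm (T i xi) <= norm p + norm q).
        { rewrite -(Rabs_pos_eq 2); [|lra]. rewrite -norm_scal_R E.
          eapply Rle_trans; [refine (norm_triangle (V := Y) _ _)|]. rewrite norm_opp. lra. }
        lra. }
  destruct Hx' as [x' [H1 H2]].
  assert (HM' : 0 < / M) by now apply Rinv_0_lt_compat.
  assert (Hr' : 0 < Rmin (r / 2) (/ M)) by (apply Rmin_pos; lra).
  exists x', (mkposreal _ Hr'). simpl. split; [apply Rmin_l|]. split; auto.
  exists i. intros y Hy.
  assert (H3 := HTM (minus y x')). rewrite linear_minus // in H3.
  assert (H4 : M * norm (minus y x') <= 1).
  { apply Rle_trans with (M * / M); [|right; field; lra].
    apply Rmult_le_compat_l; [lra|]. apply Rle_trans with (1 := Hy). apply Rmin_r. }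
  assert (E : T i x' = plus (T i y) (opp (minus (T i y) (T i x')))).
  { unfold minus. by rewrite opp_plus opp_opp plus_assoc plus_opp_r plus_zero_l. }
  assert (H5 : norm (T i x') <= norm (T i y) + norm (minus (T i y) (T i x'))).
  { rewrite {1}E. eapply Rle_trans; [refine (norm_triangle (V := Y) _ _)|].
    rewrite norm_opp. lra. }
  lra.
Qed.

(** Iterating [resonance_ball] gives nested closed balls on which some operator exceeds n in norm.
    Their common point, obtained from completeness, contradicts the pointwise bound there. *)
Lemma uniform_boundedness :
  (forall x, exists S, forall i, norm (T i x) <= S) ->
  exists N, 0 <= N /\ forall i x, norm (T i x) <= N * norm x.
Proof.
  intros Hpt. apply NNPP. intros Hno.
  assert (Hunb : forall N, 0 <= N -> exists i x, N * norm x < norm (T i x)).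
  { intros N HN. apply NNPP. intros H. apply Hno. exists N. split; auto. intros i x.
    apply Rnot_lt_le. intros Hlt. apply H. now exists i, x. }
  set (P := fun (n : nat) (s s' : X * posreal) =>
    snd s' <= snd s / 2 /\ norm (minus (fst s') (fst s)) <= snd s / 2 /\
    exists i, forall y, norm (minus y (fst s')) <= snd s' -> INR n < norm (T i y)).
  assert (Hstep : forall n s, exists s', P n s s').
  { intros n [x r]. destruct (resonance_ball Hunb n x r) as [x' [r' H]]. now exists (x', r'). }
  set (step := fun n s => proj1_sig (constructive_indefinite_description _ (Hstep n s))).
  set (s := fix s n := match n with O => (zero, mkposreal 1 Rlt_0_1) | Datatypes.S n => step n (s n) end).
  assert (HP : forall n, P n (s n) (s (Datatypes.S n))).
  { intros n. simpl. unfold step. apply proj2_sig. }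
  assert (Hseq : exists (c : nat -> X) (r : nat -> R), r O = 1 /\ (forall n, 0 < r n) /\
    forall n, r (Datatypes.S n) <= r n / 2 /\ norm (minus (c (Datatypes.S n)) (c n)) <= r n / 2 /\
      exists i, forall y, norm (minus y (c (Datatypes.S n))) <= r (Datatypes.S n) ->
        INR n < norm (T i y)).
  { exists (fun n => fst (s n)), (fun n => pos (snd (s n))). split; [reflexivity|]. split.
    - intros n. apply cond_pos.
    - exact HP. }
  clear Hunb P Hstep step s HP. destruct Hseq as [c [r [Hr0 [Hrp HP]]]].
  assert (Hpow : forall n, 0 < / 2 ^ n) by (intros; apply Rinv_0_lt_compat, pow_lt; lra).
  assert (Hr : forall n, r n <= / 2 ^ n).
  { induction n as [|n IH]; [simpl; lra|].
    destruct (HP n) as [H _].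
    rewrite -tech_pow_Rmult Rinv_mult. lra. }
  (* This inequality says that the ball of index n + k lies inside the ball of index n. *)
  assert (Hnest : forall n k, norm (minus (c (n + k)%nat) (c n)) + r (n + k)%nat <= r n).
  { intros n. induction k as [|k IH].
    - rewrite Nat.add_0_r. unfold minus. rewrite plus_opp_r norm_zero. lra.
    - rewrite Nat.add_succ_r. destruct (HP (n + k)%nat) as [H1 [H2 _]].
      assert (H3 := norm_minus_triangle (V := X) (c (Datatypes.S (n + k))) (c (n + k)%nat) (c n)).
      lra. }
  destruct (proj1 (filterlim_locally_cauchy (F := eventually) c)) as [x Hx].
  { intros e. assert (He := cond_pos e).
    destruct (pow_lt_1_zero (/ 2) ltac:(rewrite Rabs_pos_eq; lra) (e / 2) ltac:(lra)) as [n0 Hn0].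
    specialize (Hn0 n0 (le_n n0)). rewrite pow_inv in Hn0.
    rewrite Rabs_pos_eq in Hn0; [|left; apply Hpow].
    exists (fun n => (n0 <= n)%nat). split; [now exists n0|].
    assert (H : forall u, (n0 <= u)%nat -> norm (minus (c u) (c n0)) < e / 2).
    { intros u Hu. assert (H := Hnest n0 (u - n0)%nat).
      replace (n0 + (u - n0))%nat with u in H by lia. specialize (Hr n0).
      specialize (Hrp u). lra. }
    intros u v Hu Hv. refine (ball_of_norm (V := X) _ _ _ _).
    change (norm (minus (c v) (c u)) < e).
    assert (H0 := norm_minus_triangle (V := X) (c v) (c n0) (c u)).
    rewrite (norm_minus_sym (c n0)) in H0.
    assert (H1 := H u Hu). assert (H2 := H v Hv). lra. }
  assert (Hin : forall n, norm (minus x (c n)) <= r n).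
  { intros n. apply Rle_plus_epsilon. intros e He.
    destruct (proj1 (filterlim_norm_iff (V := X) eventually _ x) Hx e He) as [m Hm].
    assert (Hm' : norm (minus (c (n + m)%nat) x) < e) by (apply Hm; lia).
    assert (H0 := norm_minus_triangle (V := X) x (c (n + m)%nat) (c n)).
    rewrite (norm_minus_sym x (c (n + m)%nat)) in H0. assert (H := Hnest n m).
    specialize (Hrp (n + m)%nat). lra. }
  destruct (Hpt x) as [S HS].
  destruct (nfloor_ex (Rmax 0 S) (Rmax_l _ _)) as [n Hn].
  (* Here n is the integer part of max(0,S), so the index n + 1 is the one that exceeds S. *)
  destruct (HP (Datatypes.S n)) as [_ [_ [i Hi]]].
  specialize (Hi x (Hin _)). specialize (HS i). rewrite S_INR in Hi.
  assert (H := Rmax_r 0 S). lra.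
Qed.

End UniformBoundedness.

(** * Fractional cosine functions *)

Section FractionalCosine.

Context {X : CompleteNormedModule R_AbsRing}.
Variables (gamma delta : R) (C : R -> X -> X).
Hypothesis Hgamma : 1 < gamma < 2.
Hypothesis Hdelta : 0 <= delta <= 1.
Hypothesis HC : general_fractional_cosine gamma delta C.

Let beta : R := gamma + delta * (2 - gamma) - 1.

Lemma beta_pos : 0 < beta.
Proof. unfold beta. nra. Qed.

(** The constant value for r <= 0 is the limit in the initial condition, so the function is
    continuous on all of R, as [power_weighted] demands of a profile. *)
Definition desingularized (x : X) (r : R) : X :=
  if Rle_dec r 0 then scal (/ Gamma beta) x else scal (/ Rpower r (beta - 1)) (C r x).

Lemma desingularized_pos (x : X) (r : R) : 0 < r ->
  desingularized x r = scal (/ Rpower r (beta - 1)) (C r x).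
Proof. intros Hr. unfold desingularized. destruct (Rle_dec r 0); [lra|reflexivity]. Qed.

Lemma continuous_desingularized (x : X) (r : R) : continuous (desingularized x) r.
Proof.
  destruct (Rlt_le_dec 0 r) as [Hr|Hr].
  - apply continuous_ext_loc with (fun r => scal (/ Rpower r (beta - 1)) (C r x)).
    + exists (mkposreal _ Hr). intros y Hy. symmetry. apply desingularized_pos.
      apply Rabs_def2 in Hy. unfold minus, plus, opp in Hy; simpl in Hy. lra.
    + apply (continuous_scal (V := X)); [|now apply (gfc_continuous _ _ _ HC)].
      apply continuous_ext with (fun r => Rpower r (- (beta - 1))).
      * intros y. apply Rpower_Ropp.
      * now apply continuous_Rpower.
  - apply (proj2 (filterlim_norm_iff (V := X) _ _ _)). intros e He.
    assert (Hneg : forall y, y <= 0 -> minus (desingularized x y) (desingularized x r) = zero).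
    { intros y Hy. unfold desingularized.
      destruct (Rle_dec r 0); [|lra]. destruct (Rle_dec y 0); [|lra]. apply plus_opp_r. }
    destruct Hr as [Hr|Hr].
    + exists (mkposreal (- r) ltac:(lra)). intros y Hy. rewrite Hneg ?norm_zero //.
      apply Rabs_def2 in Hy. unfold minus, plus, opp in Hy; simpl in Hy. lra.
    + assert (H := gfc_initial _ _ _ HC x). fold beta in H.
      replace (gamma + delta * (2 - gamma) - 2) with (beta - 1) in H by (unfold beta; ring).
      destruct (proj1 (filterlim_norm_iff (V := X) (at_right 0) _ _) H e He) as [d Hd].
      exists d. intros y Hy. destruct (Rle_lt_dec y 0) as [Hy0|Hy0].
      * rewrite Hneg // norm_zero. exact He.
      * rewrite Hr in Hy. specialize (Hd y Hy Hy0). simpl in Hd.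
        rewrite desingularized_pos //. unfold desingularized. destruct (Rle_dec r 0); [|lra].
        exact Hd.
Qed.

Lemma power_weighted_C (x : X) : power_weighted beta (desingularized x) (fun t => C t x).
Proof.
  split; [apply continuous_desingularized|].
  intros r Hr. rewrite desingularized_pos // scal_assoc.
  assert (Hp := Rpower_pos r (beta - 1)).
  transitivity (scal (@one R_Ring) (C r x)); [symmetry; exact (scal_one _)|].
  f_equal. unfold mult, one; simpl. field. lra.
Qed.

Lemma is_linear_C (t : R) : 0 < t -> is_linear (C t).
Proof. apply (gfc_bounded _ _ _ HC). Qed.

Lemma is_linear_scal_R (k : R) : is_linear (fun x : X => scal k x).
Proof. apply (is_linear_scal_r (V := X) k). intros; apply Rmult_comm. Qed.

Lemma desingularized_uniform_bound (t : R) :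
  exists N, 0 <= N /\ forall r x, 0 < r <= t -> norm (desingularized x r) <= N * norm x.
Proof.
  destruct (uniform_boundedness (fun (r : {r : R | 0 < r <= t}) x => desingularized x (proj1_sig r)))
    as [N [HN H]].
  - intros [r Hr]. simpl.
    replace (fun x => desingularized x r) with (fun x => scal (/ Rpower r (beta - 1)) (C r x)).
    + apply (is_linear_comp (C r) (fun x => scal (/ Rpower r (beta - 1)) x)).
      * apply is_linear_C. lra.
      * apply is_linear_scal_R.
    + apply functional_extensionality. intros x. symmetry. apply desingularized_pos. lra.
  - intros x. destruct (bounded_continuity (desingularized x) 0 t
      (fun r _ => continuous_desingularized x r)) as [S HS].
    exists S. intros [r Hr]. simpl. left. apply HS. lra.
  - exists N. split; auto. intros r x Hr. exact (H (exist _ r Hr) x).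
Qed.

Definition JC (t : R) (x : X) : X := J gamma (fun r => C r x) t.

Lemma is_linear_JC (t : R) : 0 < t -> is_linear (JC t).
Proof.
  intros Ht. assert (Hb := beta_pos). split.
  - intros x y. apply (J_plus_ext gamma beta beta _ _ _ _ _ t ltac:(lra) Hb Hb Ht
      (power_weighted_C x) (power_weighted_C y)).
    intros r Hr. apply (linear_plus _ (is_linear_C r Hr)).
  - intros k x. unfold JC.
    rewrite (J_linear (fun z => scal k z) gamma beta _ _ t ltac:(lra) Hb Ht (is_linear_scal_R k)
      (power_weighted_C x)).
    apply (J_ext gamma beta (desingularized (scal k x))); auto; [lra|apply power_weighted_C|].
    intros r Hr. apply (linear_scal _ (is_linear_C r Hr)).
  - destruct (desingularized_uniform_bound t) as [N [HN HNb]].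
    set (K := Rpower t (gamma + beta - 1) * (/ Gamma gamma * (N * Beta gamma beta))).
    assert (HK : 0 <= K).
    { apply Rmult_le_pos; [left; apply Rpower_pos|]. apply Rmult_le_pos.
      - left. apply Rinv_0_lt_compat. apply Gamma_pos. lra.
      - apply Rmult_le_pos; auto. left. apply Beta_pos; lra. }
    (* [is_linear] requires a strictly positive bound, whereas K may vanish. *)
    exists (K + 1). split; [lra|]. intros x.
    apply Rle_trans with (K * norm x).
    + eapply Rle_trans.
      * apply (norm_J_le gamma beta (N * norm x) (desingularized x)); auto; [lra|apply power_weighted_C|].
        intros r Hr. apply HNb. lra.
      * right. unfold K. ring.
    + assert (H := norm_ge_0 x). nra.
Qed.

Lemma C_JC_comm (s t : R) (x : X) : 0 < s -> 0 < t -> C s (JC t x) = JC t (C s x).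
Proof.
  intros Hs Ht. assert (Hb := beta_pos). unfold JC.
  rewrite (J_linear (C s) gamma beta _ _ t ltac:(lra) Hb Ht (is_linear_C s Hs) (power_weighted_C x)).
  symmetry. apply (J_ext gamma beta (desingularized (C s x))); auto; [lra|apply power_weighted_C|].
  intros r Hr. now apply (gfc_comm _ _ _ HC).
Qed.

(** The numerator of the quotient defining the generator, and the combination in which the
    functional equation becomes symmetric. *)
Definition increment (t : R) (x : X) : X := minus (C t x) (scal (pow_g beta t) x).

(** Once C(s) is moved inside the fractional integral, this is the functional equation with its
    terms regrouped. *)
Lemma JC_increment_sym (s t : R) (x : X) : 0 < s -> 0 < t ->
  JC t (increment s x) = JC s (increment t x).
Proof.
  intros Hs Ht. unfold increment.
  rewrite !linear_minus; try now apply is_linear_JC.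
  rewrite (linear_scal _ (is_linear_JC t Ht)) (linear_scal _ (is_linear_JC s Hs)).
  assert (E := gfc_functional _ _ _ HC t s x Ht Hs). fold beta in E.
  change (minus (C s (JC t x)) (JC s (C t x)) =
    minus (scal (pow_g beta s) (JC t x)) (scal (pow_g beta t) (JC s x))) in E.
  rewrite C_JC_comm // in E.
  set (a := JC t (C s x)) in *. set (b := JC s (C t x)) in *.
  set (c := scal (pow_g beta s) (JC t x)) in *. set (d := scal (pow_g beta t) (JC s x)) in *.
  assert (E2 : minus a b = minus c d) by exact E.
  apply (minus_zero_eq (G := X)).
  transitivity (minus (minus a b) (minus c d)).
  - unfold minus. rewrite !opp_plus !opp_opp.
    rewrite -!plus_assoc. f_equal. rewrite !plus_assoc. f_equal. apply plus_comm.
  - rewrite E2. apply plus_opp_r.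
Qed.

Lemma JC_lim0 (x : X) :
  lim0 (fun s => scal (/ Rpower s (gamma + beta - 1)) (JC s x)) (scal (/ Gamma (gamma + beta)) x).
Proof.
  assert (Hb := beta_pos).
  assert (H := J_lim0 gamma beta _ _ ltac:(lra) Hb (power_weighted_C x)).
  replace (scal (/ Gamma (gamma + beta)) x)
    with (scal (Gamma beta / Gamma (gamma + beta)) (desingularized x 0)); [exact H|].
  unfold desingularized. destruct (Rle_dec 0 0); [|lra]. rewrite scal_assoc. f_equal.
  unfold mult; simpl. assert (G := Gamma_pos beta Hb).
  assert (G1 := Gamma_pos (gamma + beta) ltac:(lra)). field. lra.
Qed.

Lemma generator_increment (x y : X) (t : R) : generator gamma delta C x y -> 0 < t ->
  increment t x = JC t y.
Proof.
  intros [l [Hl ->]] Ht. assert (Hb := beta_pos). fold beta in Hl.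
  replace (2 * gamma + delta * (2 - gamma) - 2) with (gamma + beta - 1) in Hl by (unfold beta; ring).
  replace (2 * gamma + delta * (2 - gamma) - 1) with (gamma + beta) by (unfold beta; ring).
  assert (G1 := Gamma_pos (gamma + beta) ltac:(lra)).
  assert (H1 : lim0 (fun s => scal (/ Rpower s (gamma + beta - 1)) (JC t (increment s x))) (JC t l)).
  { apply filterlim_ext with (fun s => JC t (scal (/ Rpower s (gamma + beta - 1)) (increment s x))).
    - intros s. apply (linear_scal _ (is_linear_JC t Ht)).
    - eapply filterlim_comp; [exact Hl|]. apply (linear_cont (JC t) l). now apply is_linear_JC. }
  assert (H2 := JC_lim0 (increment t x)).
  (* Two limits of one function of s: [H1] passes the limit through the bounded operator [JC t],
     while [H2] lets [JC s] act on a fixed vector. *)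
  assert (E : JC t l = scal (/ Gamma (gamma + beta)) (increment t x)).
  { apply (filterlim_locally_unique (V := X) (F := at_right 0) _ _ _ H1).
    revert H2. apply filterlim_ext_loc.
    generalize (at_right_interval 0 1 Rlt_0_1). apply filter_imp. intros s Hs.
    rewrite (JC_increment_sym s t); auto. lra. }
  rewrite (linear_scal _ (is_linear_JC t Ht)) E scal_assoc.
  transitivity (scal (@one R_Ring) (increment t x)); [symmetry; exact (scal_one _)|].
  f_equal. unfold mult, one; simpl. field. lra.
Qed.

(** C(t) commutes with every C(s) and is continuous, so it passes through the limit defining the
    generator. *)
Lemma generator_C (x y : X) (t : R) : generator gamma delta C x y -> 0 < t ->
  generator gamma delta C (C t x) (C t y).
Proof.
  intros [l [Hl ->]] Ht. exists (C t l). assert (HL := is_linear_C t Ht). split.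
  - apply filterlim_ext_loc with (fun s => C t (scal (/ Rpower s (2 * gamma + delta * (2 - gamma) - 2))
      (minus (C s x) (scal (pow_g (gamma + delta * (2 - gamma) - 1) s) x)))).
    + generalize (at_right_interval 0 1 Rlt_0_1). apply filter_imp. intros s Hs.
      rewrite (linear_scal _ HL) linear_minus // (linear_scal _ HL).
      rewrite (gfc_comm _ _ _ HC t s); auto. lra.
    + eapply filterlim_comp; [exact Hl|]. now apply (linear_cont (C t) l).
  - apply (linear_scal _ HL).
Qed.

(** * Verification of the Cauchy problem *)

Lemma power_weighted_ext {b : R} {phi f g : R -> X} :
  power_weighted b phi f -> (forall r, 0 < r -> g r = f r) -> power_weighted b phi g.
Proof. intros [H1 H2] E. split; auto. intros r Hr. rewrite E //. now apply H2. Qed.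

Lemma deriv_pos_ext (f g f' : R -> X) :
  (forall t, 0 < t -> f t = g t) -> deriv_pos f f' -> deriv_pos g f'.
Proof.
  intros E H t Ht. apply is_derive_ext_loc with f; [|now apply H].
  exists (mkposreal _ Ht). intros y Hy. apply E.
  apply Rabs_def2 in Hy. unfold minus, plus, opp in Hy; simpl in Hy. lra.
Qed.

Lemma strong_solution_C (x : X) : dom (generator gamma delta C) x ->
  strong_solution gamma delta (generator gamma delta C) x (fun t => C t x).
Proof.
  intros [y Hy]. assert (Hb := beta_pos).
  set (a := (1 - delta) * (2 - gamma)). set (ep := delta * (2 - gamma)).
  assert (Ha : 0 <= a) by (unfold a; nra).
  assert (Hep : 0 <= ep) by (unfold ep; nra).
  (* [Hab] makes J^a turn the singular term g_beta(t) x into g_1(t) x = x, the initial value. [Hsum]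
     makes the outer integral complete the order of the remaining term to exactly 2. *)
  assert (Hab : a + beta = 1) by (unfold a, beta; ring).
  assert (Hsum : ep + (a + gamma) = 1 + 1) by (unfold a, ep; ring).
  set (f := fun t => C t y).
  assert (Wf : power_weighted beta (desingularized y) f) by apply power_weighted_C.
  assert (Ew : forall r, 0 < r -> C r x = plus (scal (pow_g beta r) x) (J gamma f r)).
  { intros r Hr. change (J gamma f r) with (JC r y). rewrite -(generator_increment x y r Hy Hr).
    unfold increment, minus. now rewrite plus_comm -plus_assoc plus_opp_l plus_zero_r. }
  assert (WJ := fun c Hc => power_weighted_J c beta _ f Hc Hb Wf).
  assert (EJ : forall t, 0 < t -> J a (fun r => C r x) t = plus x (J (a + gamma) f t)).
  { intros t Ht.
    rewrite (J_plus_ext a beta (gamma + beta) _ _ _ _ _ t Ha Hb ltac:(lra) Ht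
      (power_weighted_pow_g beta x) (WJ gamma ltac:(lra)) Ew).
    rewrite J_pow_g // (J_semigroup a gamma beta _ f t Ha ltac:(lra) Hb Ht Wf) Hab.
    f_equal. transitivity (scal (@one R_Ring) x); [|exact (scal_one _)]. f_equal.
    unfold pow_g. rewrite Rminus_diag Rpower_O // Gamma_1. unfold one; simpl. field. }
  (* As gamma > 1, the order a + gamma - 1 is positive, so J^(a+gamma) f splits as J^1 of
     J^(a+gamma-1) f. *)
  assert (Hg : deriv_pos (J a (fun r => C r x)) (J (a + gamma - 1) f)).
  { apply deriv_pos_ext with (fun t => plus x (J 1 (J (a + gamma - 1) f) t)).
    - intros t Ht. rewrite EJ // (J_semigroup 1 (a + gamma - 1) beta (desingularized y) f t); auto; try lra.
      do 2 f_equal. ring.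
    - intros t Ht. replace (J (a + gamma - 1) f t) with (plus zero (J (a + gamma - 1) f t))
        by apply plus_zero_l.
      apply (is_derive_plus (V := X)); [apply (is_derive_const (V := X))|].
      apply (is_derive_J_1 _ _ _ t) with (3 := WJ (a + gamma - 1) ltac:(lra)); lra. }
  assert (Hg0 : lim0 (J a (fun r => C r x)) x).
  { assert (H := power_weighted_lim0 (a + gamma + beta) _ _ ltac:(lra) (WJ (a + gamma) ltac:(lra))).
    apply filterlim_ext_loc with (fun t => plus x (J (a + gamma) f t)).
    - generalize (at_right_interval 0 1 Rlt_0_1). apply filter_imp. intros t Ht.
      symmetry. apply EJ. lra.
    - replace (locally x) with (locally (plus x zero)) by (f_equal; apply plus_zero_r).
      eapply (filterlim_comp_2 (fun _ => x) (J (a + gamma) f) plus);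
        [apply filterlim_const|exact H|]. apply (filterlim_plus (V := X)). }
  (* The weight exponent a + gamma - 1 + beta equals gamma > 1, so this derivative vanishes at 0. *)
  assert (Hg0' : lim0 (J (a + gamma - 1) f) zero).
  { apply (power_weighted_lim0 (a + gamma - 1 + beta) _ _ ltac:(lra) (WJ (a + gamma - 1) ltac:(lra))). }
  (* With Taylor data x and 0 the remainder is precisely J^(a+gamma) f. *)
  assert (ET : forall r, 0 < r -> taylor_rem (J a (fun r => C r x)) x zero r = J (a + gamma) f r).
  { intros r Hr. unfold taylor_rem. rewrite EJ // plus_minus_l.
    unfold minus. now rewrite scal_zero_r opp_zero plus_zero_r. }
  assert (WT := power_weighted_ext (WJ (a + gamma) ltac:(lra)) ET).
  split; [apply (gfc_continuous _ _ _ HC)|]. split; [|split; [exact Hg0|]].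
  - exists f. split; [|split].
    + split.
      * intros t Ht. apply (ex_J_weighted a beta (desingularized x)); auto. apply power_weighted_C.
      (* The regularised integral is J^2 f by [Hsum]; its successive derivatives are J^1 f and f(t)
         = C(t) y. *)
      * exists (J (a + gamma - 1) f), (J 1 f), x, zero.
        split; [exact Hg|]. split; [exact Hg0|]. split; [exact Hg0'|]. split; [|split].
        -- intros t Ht. fold ep. refine (ex_J_weighted _ _ _ _ t Hep _ Ht WT). lra.
        -- apply deriv_pos_ext with (J 1 (J 1 f)).
           ++ intros t Ht. fold ep a. rewrite (J_semigroup 1 1 beta (desingularized y) f t) //; try lra.
              rewrite (J_ext ep _ _ _ (J (a + gamma) f) t Hep _ Ht WT ET); [|lra].
              rewrite (J_semigroup ep (a + gamma) beta _ f t Hep ltac:(lra) Hb Ht Wf).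
              now rewrite Hsum.
           ++ intros t Ht. apply (is_derive_J_1 _ _ _ t) with (3 := WJ 1 Rlt_0_1); lra.
        -- intros t Ht. now apply (is_derive_J_1 beta (desingularized y)).
    + apply (gfc_continuous _ _ _ HC).
    + intros t Ht. now apply generator_C.
  - exists (J (a + gamma - 1) f). now split.
Qed.

End FractionalCosine.

Theorem theorem1 (gamma delta : R) (X : CompleteNormedModule R_AbsRing)
    (C : R -> X -> X) :
  1 < gamma < 2 -> 0 <= delta <= 1 ->
  general_fractional_cosine gamma delta C ->
  forall x : X, dom (generator gamma delta C) x ->
    strong_solution gamma delta (generator gamma delta C) x (fun t => C t x).
Proof.
  intros Hg Hd HC x Hx. now apply strong_solution_C.
Qed.
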